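(* Let $A=(a_{ijk})$, $i,j\in\{1,2\}$, $k\in\{1,2,3\}$, be a nonzero hypermatrix of format $(2,2,3)$ with entries in $\mathbb{C}$, with associated matrices of linear forms $L,M$ ($2\times 3$) and $N$ ($2\times 2$) and associated schemes $\mathcal L,\mathcal M\subseteq\mathbb{P}^1$, $\mathcal N\subseteq\mathbb{P}^2$. Then exactly one of the following cases occurs, and in each case the stated conclusions hold. (1) $\det N\in\mathbb{C}[z_1,z_2,z_3]$ defines a smooth conic. Then $\mathrm{Det}(A)\neq0$, $A$ is concise and has tensor rank $3$. (2a) $\det N$ defines a conic made of two distinct lines and the $2\times2$ minors of $L$ define one point in $\mathbb{P}^1$. Then $A$ is concise and has tensor rank $3$. (2b) $\det N$ defines a conic made of two distinct lines and the $2\times2$ minors of $L$ define two points in $\mathbb{P}^1$. Then $A$ is not concise, $F_{ess}(A)=(2,2,2)$ and $A$ has tensor rank $2$. (3a) $\det N$ defines a double line and the $2\times2$ minors of $L$ define a double point in $\mathbb{P}^1$. Then $A$ is not concise, $F_{ess}(A)=(2,2,2)$ and $A$ has tensor rank $3$. (3b) $\det N$ defines a double line and the $2\times2$ minors of $L$ vanish identically (i.e. $\mathcal L=\mathbb{P}^1$). Then $A$ is not concise, $F_{ess}(A)=(2,2,1)$ and $A$ has tensor rank $2$. (4a) $\det N=0$ identically and one between $\mathcal L$ and $\mathcal M$ is a double point. Then $A$ is not concise, $F_{ess}(A)=(1,2,2)$ or $F_{ess}(A)=(2,1,2)$, and $A$ has tensor rank $2$. (4b) $\det N=0$ identically and $\mathcal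 L=\mathcal M=\mathbb{P}^1$ (all $2\times 2$ minors of $L$ and $M$ vanish identically). Then $A$ is not concise, has tensor rank $1$ and $F_{ess}(A)=(1,1,1)$. Moreover, in all cases other than (1), $\mathrm{Det}(A)=0$ and the schemes $\mathcal L,\mathcal M,\mathcal N$ are degenerate.
   Context: Associated matrices: $L=(L_{jk})$ is $2\times3$ with $L_{jk}=\sum_i a_{ijk}x_i$; $M=(M_{ik})$ is $2\times 3$ with $M_{ik}=\sum_j a_{ijk}y_j$; $N=(N_{ij})$ is $2\times2$ with $N_{ij}=\sum_k a_{ijk}z_k$. The associated schemes $\mathcal L,\mathcal M\subseteq\mathbb{P}^1$, $\mathcal N\subseteq\mathbb{P}^2$ are the projective schemes defined by the ideals generated by the $2\times2$ minors of $L,M,N$ respectively. A double point in $\mathbb{P}^1$ is the scheme defined by the square of a nonzero linear form; a double line in $\mathbb{P}^2$ is the scheme defined by the square of a nonzero linear form. Degenerate schemes: for a scheme $\mathcal S\subseteq\mathbb{P}^{n-1}$ defined by the maximal minors of a $u\times v$ matrix ($u\le v$) of linear forms in $n$ variables, a point $P\in\mathcal S$ is degenerate if the Jacobian matrix of these maximal minors at $P$ has rank $<\min\{v-u+1,n\}$; $\mathcal S$ is degenerate if it has a degenerate point. Hyperdeterminant: the dual variety in $(\mathbb{P}^{11})^*$ of the Segre variety $\mathbb{P}^1\times\mathbb{P}^1\times\mathbb{P}^2\subset\mathbb{P}^{11}$ (coordinates $w_{ijk}$) is a hypersurface; let $D$ generate its ideal and $\mathrm{Det}(A)=D(H_A)$,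 where $H_A$ is the hyperplane $\sum a_{ijk}w_{ijk}=0$ (only its vanishing is meaningful). It is known (Gelfand–Kapranov–Zelevinsky) that $\mathrm{Det}(A)=0$ if and only if $A$ is degenerate, i.e. there is $(x,y,z)\in\mathbb{P}^1\times\mathbb{P}^1\times\mathbb{P}^2$ with $\sum_{i,j}a_{ijk}x_iy_j=0$ for all $k$, $\sum_{i,k}a_{ijk}x_iz_k=0$ for all $j$ and $\sum_{j,k}a_{ijk}y_jz_k=0$ for all $i$. Tensor rank of $A$: the minimal number of decomposable tensors $u\otimes v\otimes w$ whose sum is $\sum a_{ijk}\,\varepsilon_i\otimes\eta_j\otimes\zeta_k\in\mathbb{C}^2\otimes\mathbb{C}^2\otimes\mathbb{C}^3$, where $(\varepsilon_i),(\eta_j),(\zeta_k)$ are the fixed bases. Conciseness and essential format: let $P_A=\sum a_{ijk}x_iy_jz_k$. The essential format $F_{ess}(A)$ is the (componentwise) minimum $(p',q',r')$ such that there are linear forms $x'_1,\dots,x'_{p'}$ in the $x_i$, $y'_1,\dots,y'_{q'}$ in the $y_j$, $z'_1,\dots,z'_{r'}$ in the $z_k$ with $P_A$ a trihomogeneous polynomial of degree $(1,1,1)$ in $x',y',z'$. $A$ is concise if $F_{ess}(A)=(2,2,3)$. *)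

(* Defs.v *)
From HB Require Import structures.
From mathcomp Require Import all_boot all_order all_algebra.
From mathcomp Require Export reals complex mpoly.

Set Implicit Arguments.
Unset Strict Implicit.
Unset Printing Implicit Defensive.

Import GRing.Theory.
Local Open Scope ring_scope.

Section ProjectiveSchemes.
Variables (C : fieldType) (n : nat).
Implicit Types (f g h l : {mpoly C[n]}) (gs hs : seq {mpoly C[n]}).

Definition in_ideal gs f : Prop :=
  exists c : 'I_(size gs) -> {mpoly C[n]}, f = \sum_(i < size gs) c i * gs`_i.

(* Saturation of the ideal (gs) by the irrelevant ideal ('X_0, ..., 'X_(n-1)):
   f is in it when some power of the irrelevant ideal multiplies f into (gs). *)
Definition in_saturation gs f : Prop :=
  exists m : nat, forall h, h \is m.-homog -> in_ideal gs (h * f).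

(* Closed subschemes of P^(n-1) correspond bijectively to saturated homogeneous
   ideals, so two homogeneous ideals define the same projective scheme iff
   their saturations coincide. *)
Definition same_scheme gs hs : Prop :=
  forall f, in_saturation gs f <-> in_saturation hs f.

(* A hyperplane of P^(n-1) is a point when n = 2 and a line when n = 3. *)
Definition is_hyperplane gs : Prop :=
  exists l, [/\ l \is 1.-homog, l != 0 & same_scheme gs [:: l]].

Definition is_double_hyperplane gs : Prop :=
  exists l, [/\ l \is 1.-homog, l != 0 & same_scheme gs [:: l ^+ 2]].

Definition is_two_hyperplanes gs : Prop :=
  exists l1 l2,
    [/\ l1 \is 1.-homog, l2 \is 1.-homog, l2 != 0,
        forall c : C, l1 != c *: l2
      & same_scheme gs [:: l1 * l2]].

Definition is_whole_space gs : Prop := same_scheme gs [:: 0].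

Definition proj_point (P : 'I_n -> C) : Prop := exists i, P i != 0.

(* For a homogeneous quadratic form f in three variables this says that the
   conic f = 0 is smooth, by the Jacobian criterion. *)
Definition is_smooth_hypersurface f : Prop :=
  f != 0 /\
  forall P, proj_point P -> f.@[P] = 0 -> exists i, (f^`M(i)).@[P] != 0.

Definition jacobian gs (P : 'I_n -> C) : 'M[C]_(size gs, n) :=
  \matrix_(i < size gs, j < n) ((gs`_i)^`M(j)).@[P].

End ProjectiveSchemes.

Section Minors.
Variables (C : fieldType) (n u v : nat).
Implicit Types (B : 'M[{mpoly C[n]}]_(u, v)).

Definition column_choices : seq {ffun 'I_u -> 'I_v} :=
  enum [pred s : {ffun 'I_u -> 'I_v} |
         [forall i : 'I_u, forall j : 'I_u, (i < j)%N ==> (s i < s j)%N]].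

Definition max_minors B : seq {mpoly C[n]} :=
  [seq \det (colsub (fun i => s i) B) | s : {ffun 'I_u -> 'I_v} <- column_choices].

(* Meant for u <= v. *)
Definition degenerate_point B (P : 'I_n -> C) : Prop :=
  [/\ proj_point P,
      forall g, g \in max_minors B -> g.@[P] = 0
    & (\rank (jacobian (max_minors B) P) < minn (v - u).+1 n)%N].

Definition degenerate_scheme B : Prop := exists P, degenerate_point B P.

End Minors.

Section Hypermatrices.
Variable C : fieldType.

Definition hypermatrix := 'I_2 -> 'I_2 -> 'I_3 -> C.
Implicit Types A w : hypermatrix.

Definition hnonzero A : Prop := exists i j k, A i j k != 0.

Definition Lmx A : 'M[{mpoly C[2]}]_(2, 3) :=
  \matrix_(j < 2, k < 3) \sum_(i < 2) A i j k *: 'X_i.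
Definition Mmx A : 'M[{mpoly C[2]}]_(2, 3) :=
  \matrix_(i < 2, k < 3) \sum_(j < 2) A i j k *: 'X_j.
Definition Nmx A : 'M[{mpoly C[3]}]_(2, 2) :=
  \matrix_(i < 2, j < 2) \sum_(k < 3) A i j k *: 'X_k.

(* Tensor rank: tensors of C^2 (x) C^2 (x) C^3 are given by their coordinates
   on the fixed bases. *)
Definition sum_of_decomposables A (r : nat) : Prop :=
  exists (a : 'I_r -> 'I_2 -> C) (b : 'I_r -> 'I_2 -> C) (c : 'I_r -> 'I_3 -> C),
    forall i j k, A i j k = \sum_(s < r) a s i * b s j * c s k.

Definition has_tensor_rank A (r : nat) : Prop :=
  sum_of_decomposables A r /\
  forall r', sum_of_decomposables A r' -> (r <= r')%N.

(* P_A lives in the polynomial ring in x_0, x_1, y_0, y_1, z_0, z_1, z_2. *)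
Definition xvar (i : 'I_2) : {mpoly C[2 + 2 + 3]} := 'X_(lshift 3 (lshift 2 i)).
Definition yvar (j : 'I_2) : {mpoly C[2 + 2 + 3]} := 'X_(lshift 3 (rshift 2 j)).
Definition zvar (k : 'I_3) : {mpoly C[2 + 2 + 3]} := 'X_(rshift (2 + 2) k).

Definition PA A : {mpoly C[2 + 2 + 3]} :=
  \sum_(i < 2) \sum_(j < 2) \sum_(k < 3)
    A i j k *: (xvar i * yvar j * zvar k).

(* The trihomogeneous polynomials of degree (1,1,1) in x', y', z' are the
   linear combinations of the products x'_a y'_b z'_c. *)
Definition expressible_in_format A (p q r : nat) : Prop :=
  exists (x' : 'I_p -> {mpoly C[2 + 2 + 3]})
         (y' : 'I_q -> {mpoly C[2 + 2 + 3]})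
         (z' : 'I_r -> {mpoly C[2 + 2 + 3]})
         (t : 'I_p -> 'I_q -> 'I_r -> C),
    [/\ forall a, exists e : 'I_2 -> C, x' a = \sum_(i < 2) e i *: xvar i,
        forall b, exists e : 'I_2 -> C, y' b = \sum_(j < 2) e j *: yvar j,
        forall c, exists e : 'I_3 -> C, z' c = \sum_(k < 3) e k *: zvar k
      & PA A = \sum_(a < p) \sum_(b < q) \sum_(c < r)
                 t a b c *: (x' a * y' b * z' c)].

Definition Fess A (p q r : nat) : Prop :=
  expressible_in_format A p q r /\
  forall p' q' r', expressible_in_format A p' q' r' ->
    [/\ (p <= p')%N, (q <= q')%N & (r <= r')%N].

Definition concise A : Prop := Fess A 2 2 3.

(* Embedded tangent space of (the affine cone over) the Segre variety at
   x (x) y (x) z: the span of the partial derivatives of the parametrization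
   w_ijk = x_i y_j z_k. *)
Definition segre_tangent (x y : 'I_2 -> C) (z : 'I_3 -> C) w : Prop :=
  exists (x1 y1 : 'I_2 -> C) (z1 : 'I_3 -> C),
    forall i j k, w i j k = x1 i * y j * z k + x i * y1 j * z k + x i * y j * z1 k.

Definition in_hyperplane A w : Prop :=
  \sum_(i < 2) \sum_(j < 2) \sum_(k < 3) A i j k * w i j k = 0.

Definition tangent_hyperplane A : Prop :=
  hnonzero A /\
  exists x y z, [/\ proj_point x, proj_point y, proj_point z
    & forall w, segre_tangent x y z w -> in_hyperplane A w].

(* Polynomials in the 12 coordinates a_ijk of the dual projective space. *)
Definition hindex := ('I_2 * 'I_2 * 'I_3)%type.
Definition dual_poly := {mpoly C[#|{: hindex}|]}.

Definition heval (D : dual_poly) A : C :=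
  D.@[fun m => let t : hindex := enum_val m in A t.1.1 t.1.2 t.2].

(* The dual variety: the Zariski closure of the set of hyperplanes tangent to
   the Segre variety.  That set is a cone, so testing against all polynomials
   or only against homogeneous ones gives the same closure. *)
Definition in_dual_variety A : Prop :=
  hnonzero A /\
  forall f : dual_poly,
    (forall B, tangent_hyperplane B -> heval f B = 0) -> heval f A = 0.

(* D generates the ideal of the dual variety; such a D is unique up to a
   nonzero scalar, and Det(A) is heval D A. *)
Definition is_hyperdeterminant (D : dual_poly) : Prop :=
  forall f : dual_poly,
    (forall A, in_dual_variety A -> heval f A = 0) <->
    exists g : dual_poly, f = g * D.

Inductive hcase := Case1 | Case2a | Case2b | Case3a | Case3b | Case4a | Case4b.

Definition in_case A (c : hcase) : Prop :=
  let detN := \det (Nmx A) in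
  match c with
  | Case1  => is_smooth_hypersurface detN
  | Case2a => is_two_hyperplanes [:: detN] /\ is_hyperplane (max_minors (Lmx A))
  | Case2b => is_two_hyperplanes [:: detN] /\
              is_two_hyperplanes (max_minors (Lmx A))
  | Case3a => is_double_hyperplane [:: detN] /\
              is_double_hyperplane (max_minors (Lmx A))
  | Case3b => is_double_hyperplane [:: detN] /\
              (forall g, g \in max_minors (Lmx A) -> g = 0)
  | Case4a => detN = 0 /\
              (is_double_hyperplane (max_minors (Lmx A)) \/
               is_double_hyperplane (max_minors (Mmx A)))
  | Case4b => detN = 0 /\
              (is_whole_space (max_minors (Lmx A)) /\
               is_whole_space (max_minors (Mmx A)))
  end.

End Hypermatrices.

(* Main.v *)
Require Import Defs.
From mathcomp Require Import all_boot all_order all_algebra.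
From mathcomp Require Import boolp ring.

(** Everything is governed by isotropic pairs: nonzero [x], [y] with
    [x^T N_k y = 0] for the three slices [N_k] of [A].  An isotropic pair always
    extends to a triple [(x, y, z)] at which the hyperplane of [A] is tangent to
    the Segre variety; [z] is then a singular point of [det N], while [x] and [y]
    are common zeros of the minors of [L] and [M].  Conversely a singular point
    of [det N] yields an isotropic pair.  So without isotropic pair [det N] is a
    smooth conic; its discriminant, as a polynomial in the entries of [A],
    vanishes on the dual variety and is therefore a multiple of the
    hyperdeterminant.  With an isotropic pair, a change of bases puts [N] in the
    form [[p, q], [r, 0]], and the linear relations between [p], [q] and [r]
    lead to concise normal forms, one for each remaining case (two for 4a).  The
    cases exclude each other because the schemes involved have different zero
    sets, or different multiplicities along them. *)

Set Implicit Arguments.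
Unset Strict Implicit.
Unset Printing Implicit Defensive.

Import GRing.Theory.
Local Open Scope ring_scope.

(** Isotropic pairs involve only the slices and no third vector, so they behave well under
    independent base changes of the first two factors; the vector [z] is recovered afterwards by
    linear algebra. Algebraic closure enters through one root of a binary quadratic form, and the
    characteristic through Euler's identity, which divides by 2. Base changes use matrices with
    independent rows, possibly rectangular, so that the size of a normal form is the essential
    format of [A]. A concise normal form bounds all formats of [A] from below, and with them the
    tensor rank, because [s] decomposable summands are an expression in format (s, s, s). Explicit
    decompositions attain this bound except in case 3a, where the format (2, 2, 2) does not exclude
    rank 2 and a separate argument is required. *)

Section LinearAlgebra.
Variable F : fieldType.

(** * Kernels, small determinants and rank-one matrices *)

Lemma sum_mulr_delta n (f : 'I_n -> F) l : \sum_a f a * (a == l)%:R = f l.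
Proof.
rewrite (bigD1 l) //= eqxx mulr1 big1 ?addr0 // => a ai.
by rewrite (negPf ai) mulr0.
Qed.

Lemma exists_orthogonal_vector p n (E : 'I_p -> 'I_n -> F) : (p < n)%N ->
  exists x : 'I_n -> F, proj_point x /\ forall a, \sum_i E a i * x i = 0.
Proof.
move=> lt_pn; pose M := \matrix_(i < n, a < p) E a i.
have : kermx M != 0.
  rewrite kermx_eq0 -row_leq_rank -ltnNge.
  by apply: leq_ltn_trans lt_pn; apply: rank_leq_col.
case/rowV0Pn => u /sub_kermxP uM /rV0Pn [i ui].
exists (fun i => u 0 i); split; first by exists i.
move=> a; move/rowP/(_ a): uM; rewrite !mxE => uM0; rewrite -[RHS]uM0.
by apply: eq_bigr => j _; rewrite !mxE mulrC.
Qed.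

Lemma not_row_free r n (v : 'M[F]_(r, n)) : ~~ row_free v ->
  exists u : 'I_r -> F, proj_point u /\ forall k, \sum_a u a * v a k = 0.
Proof.
rewrite -kermx_eq0 => /rowV0Pn [u /sub_kermxP uv /rV0Pn [i ui]].
exists (fun i => u 0 i); split; first by exists i.
by move=> k; move/rowP/(_ k): uv; rewrite !mxE.
Qed.

Lemma row_free_kill r n (v : 'M[F]_(r, n)) (u : 'I_r -> F) : row_free v ->
  (forall k, \sum_a u a * v a k = 0) -> forall a, u a = 0.
Proof.
move=> fv uv a; pose w := \row_b u b.
suff w0 : w = 0 by move/rowP/(_ a): w0; rewrite !mxE.
apply: (row_free_inj fv); rewrite mul0mx; apply/rowP => k; rewrite !mxE.
by rewrite -[RHS](uv k); apply: eq_bigr => b _; rewrite mxE.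
Qed.

Lemma row_free_crit r n (v : 'M[F]_(r, n)) :
  (forall u : 'I_r -> F, (forall k, \sum_a u a * v a k = 0) ->
     forall a, u a = 0) -> row_free v.
Proof.
move=> H; apply/negPn/negP => /not_row_free [u [[a ua] uv]].
by move: ua; rewrite (H u uv a) eqxx.
Qed.

Lemma sum2 (V : nmodType) (f : 'I_2 -> V) : \sum_i f i = f 0 + f 1.
Proof. by rewrite !big_ord_recl big_ord0 addr0; congr (_ + f _); apply: val_inj. Qed.

Lemma sum3 (V : nmodType) (f : 'I_3 -> V) : \sum_i f i = f 0 + f 1 + f ord_max.
Proof.
rewrite !big_ord_recl big_ord0 addr0 addrA.
by congr (_ + f _ + f _); apply: val_inj.
Qed.

Lemma ord2P (P : 'I_2 -> Prop) : P 0 -> P 1 -> forall i, P i.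
Proof.
move=> P0 P1 [[|[|//]] i2]; first by rewrite (_ : Ordinal _ = 0) //; apply: val_inj.
by rewrite (_ : Ordinal _ = 1) //; apply: val_inj.
Qed.

Lemma ord3P (P : 'I_3 -> Prop) : P 0 -> P 1 -> P ord_max -> forall i, P i.
Proof.
move=> P0 P1 P2 [[|[|[|//]]] i3].
- by rewrite (_ : Ordinal _ = 0) //; apply: val_inj.
- by rewrite (_ : Ordinal _ = 1) //; apply: val_inj.
- by rewrite (_ : Ordinal _ = ord_max) //; apply: val_inj.
Qed.

Lemma det2E (R : comNzRingType) (M : 'M[R]_2) : \det M = M 0 0 * M 1 1 - M 0 1 * M 1 0.
Proof.
rewrite (expand_det_row _ 0) sum2 /cofactor !det_mx11 !mxE /=.
rewrite (_ : lift 0 0 = 1); last exact: val_inj.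
rewrite (_ : lift 1 0 = 0 :> 'I_2); last exact: val_inj.
by rewrite /= expr0 expr1 mul1r mulN1r mulrN.
Qed.

Lemma det3E (R : comNzRingType) (M : 'M[R]_3) : \det M =
  M ord_max 0 * (M 0 1 * M 1 ord_max - M 0 ord_max * M 1 1) +
  M ord_max 1 * (M 0 ord_max * M 1 0 - M 0 0 * M 1 ord_max) +
  M ord_max ord_max * (M 0 0 * M 1 1 - M 0 1 * M 1 0).
Proof.
have liftE (a : 'I_3) (b : 'I_2) (c : 'I_3) : bump a b = c -> lift a b = c.
  by move=> E; apply: val_inj.
rewrite (expand_det_row _ ord_max) sum3 /cofactor !det2E !mxE.
rewrite !(liftE ord_max 0 0) // !(liftE ord_max 1 1) //.
rewrite !(liftE 0 0 1) // !(liftE 0 1 ord_max) // !(liftE 1 0 0) // !(liftE 1 1 ord_max) //.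
(* The cofactor signs have sums of ordinals as exponents; they are converted to numerals so that
   [exprS] can unfold them. *)
rewrite -[(ord_max + (0%R : 'I_3))%N]/2%N -[(ord_max + (1%R : 'I_3))%N]/3%N.
rewrite -[((ord_max : 'I_3) + (ord_max : 'I_3))%N]/4%N !exprS expr0.
by ring.
Qed.

Lemma row_free_det2 (g : 'M[F]_2) : row_free g -> g 0 0 * g 1 1 - g 0 1 * g 1 0 != 0.
Proof. by rewrite row_free_unit unitmxE unitfE det2E. Qed.

Lemma rank_one_factor (n : 'I_2 -> 'I_2 -> F) :
  n 0 0 * n 1 1 - n 0 1 * n 1 0 = 0 -> (exists i j, n i j != 0) ->
  exists x y : 'I_2 -> F, [/\ proj_point x, proj_point y & forall i j, n i j = x i * y j].
Proof.
move=> d0 [i [j nij]].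
(* A matrix of rank one is the product of the column and the row through any nonzero entry, divided
   by that entry. *)
exists (fun a => n a j / n i j), (fun b => n i b); split.
- by exists i; rewrite divff ?oner_neq0.
- by exists j.
move=> a b; rewrite mulrAC; apply: (mulIf nij); rewrite divfK //.
have d0' : n 0 0 * n 1 1 = n 0 1 * n 1 0 by apply/eqP; rewrite -subr_eq0 d0.
move: i j {nij} a b.
by elim/ord2P; elim/ord2P; elim/ord2P; elim/ord2P; first [ring | ring: d0'].
Qed.

End LinearAlgebra.

(** * Multilinear substitutions, essential format and tensor rank *)

Section Tensors.
Variable F : fieldType.

Definition tensor p q r := 'I_p -> 'I_q -> 'I_r -> F.

Definition mul1 p p' q r (g : 'M[F]_(p, p')) (T : tensor p q r) : tensor p' q r :=
  fun i j k => \sum_a g a i * T a j k.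
Definition mul2 p q q' r (h : 'M[F]_(q, q')) (T : tensor p q r) : tensor p q' r :=
  fun i j k => \sum_b h b j * T i b k.
Definition mul3 p q r r' (m : 'M[F]_(r, r')) (T : tensor p q r) : tensor p q r' :=
  fun i j k => \sum_c m c k * T i j c.

(** Reading the rows of [g], [h] and [m] as linear forms, this substitutes them into the trilinear
    form of [T]. Rectangular matrices let a small tensor sit inside a larger format. *)
Definition mulT p p' q q' r r' (g : 'M[F]_(p, p')) (h : 'M[F]_(q, q'))
    (m : 'M[F]_(r, r')) (T : tensor p q r) : tensor p' q' r' :=
  mul1 g (mul2 h (mul3 m T)).

Lemma tensorP p q r (T U : tensor p q r) : (forall i j k, T i j k = U i j k) -> T = U.
Proof. by move=> TU; do 3!apply: funext => ?. Qed.

Section Modes.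
Variables p p' p'' q q' q'' r r' r'' : nat.

Lemma mul1A (g : 'M[F]_(p, p')) (g' : 'M[F]_(p', p'')) (T : tensor p q r) :
  mul1 g' (mul1 g T) = mul1 (g *m g') T.
Proof.
apply: tensorP => i j k; rewrite /mul1.
under eq_bigr => a _ do rewrite mulr_sumr.
rewrite exchange_big; apply: eq_bigr => b _; rewrite mxE mulr_suml.
by apply: eq_bigr => a _; rewrite mulrCA mulrA.
Qed.

Lemma mul2A (g : 'M[F]_(q, q')) (g' : 'M[F]_(q', q'')) (T : tensor p q r) :
  mul2 g' (mul2 g T) = mul2 (g *m g') T.
Proof.
apply: tensorP => i j k; rewrite /mul2.
under eq_bigr => a _ do rewrite mulr_sumr.
rewrite exchange_big; apply: eq_bigr => b _; rewrite mxE mulr_suml.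
by apply: eq_bigr => a _; rewrite mulrCA mulrA.
Qed.

Lemma mul3A (g : 'M[F]_(r, r')) (g' : 'M[F]_(r', r'')) (T : tensor p q r) :
  mul3 g' (mul3 g T) = mul3 (g *m g') T.
Proof.
apply: tensorP => i j k; rewrite /mul3.
under eq_bigr => a _ do rewrite mulr_sumr.
rewrite exchange_big; apply: eq_bigr => b _; rewrite mxE mulr_suml.
by apply: eq_bigr => a _; rewrite mulrCA mulrA.
Qed.

Lemma mul12C (g : 'M[F]_(p, p')) (h : 'M[F]_(q, q')) (T : tensor p q r) :
  mul1 g (mul2 h T) = mul2 h (mul1 g T).
Proof.
apply: tensorP => i j k; rewrite /mul1 /mul2.
under eq_bigr => a _ do rewrite mulr_sumr.
rewrite exchange_big; apply: eq_bigr => b _; rewrite mulr_sumr.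
by apply: eq_bigr => a _; rewrite mulrCA.
Qed.

Lemma mul13C (g : 'M[F]_(p, p')) (h : 'M[F]_(r, r')) (T : tensor p q r) :
  mul1 g (mul3 h T) = mul3 h (mul1 g T).
Proof.
apply: tensorP => i j k; rewrite /mul1 /mul3.
under eq_bigr => a _ do rewrite mulr_sumr.
rewrite exchange_big; apply: eq_bigr => b _; rewrite mulr_sumr.
by apply: eq_bigr => a _; rewrite mulrCA.
Qed.

Lemma mul23C (g : 'M[F]_(q, q')) (h : 'M[F]_(r, r')) (T : tensor p q r) :
  mul2 g (mul3 h T) = mul3 h (mul2 g T).
Proof.
apply: tensorP => i j k; rewrite /mul2 /mul3.
under eq_bigr => a _ do rewrite mulr_sumr.
rewrite exchange_big; apply: eq_bigr => b _; rewrite mulr_sumr.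
by apply: eq_bigr => a _; rewrite mulrCA.
Qed.

End Modes.

Lemma mulTA p p' p'' q q' q'' r r' r''
    (g : 'M[F]_(p, p')) (g' : 'M[F]_(p', p'')) (h : 'M[F]_(q, q'))
    (h' : 'M[F]_(q', q'')) (m : 'M[F]_(r, r')) (m' : 'M[F]_(r', r''))
    (T : tensor p q r) :
  mulT g' h' m' (mulT g h m T) = mulT (g *m g') (h *m h') (m *m m') T.
Proof. by rewrite /mulT -mul1A -mul2A -mul3A !(mul12C, mul13C, mul23C). Qed.

Lemma mulT1 p q r (T : tensor p q r) : mulT 1%:M 1%:M 1%:M T = T.
Proof.
have delta n (f : 'I_n -> F) i : \sum_a (1%:M : 'M_n) a i * f a = f i.
  rewrite (bigD1 i) //= mxE eqxx mul1r big1 ?addr0 // => a ai.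
  by rewrite mxE (negPf ai) mul0r.
by apply: tensorP => i j k; rewrite /mulT /mul1 /mul2 /mul3 !delta.
Qed.

(** Independent rows give a right inverse even for rectangular matrices, so the substitution can be
    undone. *)
Lemma mulT_inverse p p' q q' r r' (g : 'M[F]_(p, p')) (h : 'M[F]_(q, q'))
    (m : 'M[F]_(r, r')) : row_free g -> row_free h -> row_free m ->
  exists g' h' m', forall T : tensor p q r, T = mulT g' h' m' (mulT g h m T).
Proof.
move=> /row_freeP [g' gg'] /row_freeP [h' hh'] /row_freeP [m' mm'].
by exists g', h', m' => T; rewrite mulTA gg' hh' mm' mulT1.
Qed.

Definition has_format p q r (T : tensor p q r) p' q' r' : Prop :=
  exists g h m (t : tensor p' q' r'), T = mulT g h m t.

Definition killed1 p q r (T : tensor p q r) (x : 'I_p -> F) :=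
  forall j k, \sum_i x i * T i j k = 0.
Definition killed2 p q r (T : tensor p q r) (y : 'I_q -> F) :=
  forall i k, \sum_j y j * T i j k = 0.
Definition killed3 p q r (T : tensor p q r) (z : 'I_r -> F) :=
  forall i j, \sum_k z k * T i j k = 0.

(** Fewer than [p] linear forms in [p] variables have a common nonzero zero, and contraction with
    this vector kills the tensor. *)
Lemma format_killed1 p q r (T : tensor p q r) p' q' r' :
  has_format T p' q' r' -> (p' < p)%N -> exists x, proj_point x /\ killed1 T x.
Proof.
case=> g [h [m [t ->]]] /(exists_orthogonal_vector g) [x [x0 gx]].
exists x; split=> // j k; rewrite /mulT /mul1.
under eq_bigr => a _ do rewrite mulr_sumr.
rewrite exchange_big big1 //= => b _.
under eq_bigr => a _ do rewrite mulrA.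
by rewrite -mulr_suml; under eq_bigr => a _ do rewrite mulrC; rewrite gx mul0r.
Qed.

Lemma format_killed2 p q r (T : tensor p q r) p' q' r' :
  has_format T p' q' r' -> (q' < q)%N -> exists x, proj_point x /\ killed2 T x.
Proof.
case=> g [h [m [t ->]]] /(exists_orthogonal_vector h) [x [x0 gx]].
exists x; split=> // j k; rewrite /mulT mul12C /mul2.
under eq_bigr => a _ do rewrite mulr_sumr.
rewrite exchange_big big1 //= => b _.
under eq_bigr => a _ do rewrite mulrA.
by rewrite -mulr_suml; under eq_bigr => a _ do rewrite mulrC; rewrite gx mul0r.
Qed.

Lemma format_killed3 p q r (T : tensor p q r) p' q' r' :
  has_format T p' q' r' -> (r' < r)%N -> exists x, proj_point x /\ killed3 T x.
Proof.
case=> g [h [m [t ->]]] /(exists_orthogonal_vector m) [x [x0 gx]].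
exists x; split=> // j k; rewrite /mulT mul23C mul13C /mul3.
under eq_bigr => a _ do rewrite mulr_sumr.
rewrite exchange_big big1 //= => b _.
under eq_bigr => a _ do rewrite mulrA.
by rewrite -mulr_suml; under eq_bigr => a _ do rewrite mulrC; rewrite gx mul0r.
Qed.

(** Injectivity of the three contractions. By [concise_format] it bounds every format from below, so
    minimality reduces to a few linear equations. *)
Definition concise_tensor p q r (T : tensor p q r) : Prop :=
  [/\ forall x, killed1 T x -> forall i, x i = 0,
      forall y, killed2 T y -> forall j, y j = 0
    & forall z, killed3 T z -> forall k, z k = 0].

Lemma concise_format p q r (T : tensor p q r) p' q' r' :
  concise_tensor T -> has_format T p' q' r' -> [/\ p <= p', q <= q' & r <= r']%N.
Proof.
case=> c1 c2 c3 Tf; split; rewrite leqNgt; apply/negP => lt.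
- by have [x [[i xi] /c1/(_ i) x0]] := format_killed1 Tf lt; rewrite x0 eqxx in xi.
- by have [x [[i xi] /c2/(_ i) x0]] := format_killed2 Tf lt; rewrite x0 eqxx in xi.
- by have [x [[i xi] /c3/(_ i) x0]] := format_killed3 Tf lt; rewrite x0 eqxx in xi.
Qed.

(** Sums of [s] decomposable tensors are exactly the images of this diagonal tensor under [mulT], so
    rank decompositions follow base changes in the same way as formats. *)
Definition unit_tensor s : tensor s s s := fun a b c => ((a == b) && (b == c))%:R.
Arguments unit_tensor : clear implicits.

Lemma mulT_unit s p q r (a : 'M[F]_(s, p)) (b : 'M[F]_(s, q)) (c : 'M[F]_(s, r)) i j k :
  mulT a b c (unit_tensor s) i j k = \sum_l a l i * b l j * c l k.
Proof.
apply: eq_bigr => l _; rewrite -mulrA; congr (_ * _); rewrite /mul2.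
rewrite (bigD1 l) //= big1 => [|l' l'l].
  rewrite addr0; congr (_ * _); rewrite /mul3 (bigD1 l) //= big1 ?addr0 => [|l' l'l].
    by rewrite /unit_tensor !eqxx mulr1.
  by rewrite /unit_tensor (eq_sym l l') (negPf l'l) andbF mulr0.
rewrite /mul3 big1 ?mulr0 // => l'' _.
by rewrite /unit_tensor (eq_sym l l') (negPf l'l) mulr0.
Qed.

Definition decomposes p q r (T : tensor p q r) s : Prop :=
  exists a b c, T = mulT a b c (unit_tensor s).

Lemma decomposes_mulT p p' q q' r r' (g : 'M[F]_(p, p')) (h : 'M[F]_(q, q'))
    (m : 'M[F]_(r, r')) (T : tensor p q r) s :
  decomposes T s -> decomposes (mulT g h m T) s.
Proof. by case=> a [b [c ->]]; rewrite mulTA; do 3!eexists. Qed.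

Lemma sum_of_decomposablesE (A : hypermatrix F) s :
  sum_of_decomposables A s <-> decomposes (A : tensor 2 2 3) s.
Proof.
split=> [[a [b [c Aabc]]] | [a [b [c ->]]]].
  exists (\matrix_(l, i) a l i), (\matrix_(l, i) b l i), (\matrix_(l, i) c l i).
  apply: tensorP => i j k; rewrite mulT_unit Aabc.
  by apply: eq_bigr => l _; rewrite !mxE.
by exists a, b, c => i j k; rewrite mulT_unit.
Qed.

Definition form p q r n (T : tensor p q r) (X : 'I_p -> {mpoly F[n]})
    (Y : 'I_q -> {mpoly F[n]}) (Z : 'I_r -> {mpoly F[n]}) : {mpoly F[n]} :=
  \sum_a \sum_b \sum_c T a b c *: (X a * Y b * Z c).

Section Form.
Variables p p' q q' r r' n : nat.

Lemma form_mul1 (g : 'M[F]_(p, p')) (T : tensor p q r) X Y Z :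
  form (mul1 g T) X Y Z = form T (fun a => \sum_i g a i *: X i) Y Z :> {mpoly F[n]}.
Proof.
rewrite /form exchange_big [RHS]exchange_big; apply: eq_bigr => b _.
rewrite exchange_big [RHS]exchange_big; apply: eq_bigr => c _ /=.
under eq_bigr => i _ do rewrite scaler_suml.
rewrite exchange_big; apply: eq_bigr => a _ /=.
rewrite !mulr_suml scaler_sumr; apply: eq_bigr => i _.
by rewrite -!scalerAl scalerA mulrC.
Qed.

Lemma form_mul2 (g : 'M[F]_(q, q')) (T : tensor p q r) X Y Z :
  form (mul2 g T) X Y Z = form T X (fun b => \sum_j g b j *: Y j) Z :> {mpoly F[n]}.
Proof.
rewrite /form; apply: eq_bigr => a _.
rewrite exchange_big [RHS]exchange_big; apply: eq_bigr => c _ /=.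
under eq_bigr => i _ do rewrite scaler_suml.
rewrite exchange_big; apply: eq_bigr => b _ /=.
rewrite mulr_sumr mulr_suml scaler_sumr; apply: eq_bigr => i _.
by rewrite -scalerAr -scalerAl scalerA mulrC.
Qed.

Lemma form_mul3 (g : 'M[F]_(r, r')) (T : tensor p q r) X Y Z :
  form (mul3 g T) X Y Z = form T X Y (fun c => \sum_k g c k *: Z k) :> {mpoly F[n]}.
Proof.
rewrite /form; apply: eq_bigr => a _; apply: eq_bigr => b _ /=.
under eq_bigr => i _ do rewrite scaler_suml.
rewrite exchange_big; apply: eq_bigr => c _ /=.
rewrite mulr_sumr scaler_sumr; apply: eq_bigr => i _.
by rewrite -scalerAr scalerA mulrC.
Qed.

End Form.

Lemma form_mulT p p' q q' r r' n (g : 'M[F]_(p, p')) (h : 'M[F]_(q, q'))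
    (m : 'M[F]_(r, r')) (T : tensor p q r) X Y Z :
  form (mulT g h m T) X Y Z =
  form T (fun a => \sum_i g a i *: X i) (fun b => \sum_j h b j *: Y j)
         (fun c => \sum_k m c k *: Z k) :> {mpoly F[n]}.
Proof. by rewrite /mulT form_mul1 form_mul2 form_mul3. Qed.

(* Evaluating P_A at a triple of basis vectors gives back the entry of A. *)
Lemma PA_inj (A B : hypermatrix F) : PA A = PA B -> A = B.
Proof.
move=> AB; apply: tensorP => i j k.
pose P (u : 'I_(2 + 2 + 3)) : F := match split u with
  | inl v => match split v with inl a => (a == i)%:R | inr b => (b == j)%:R end
  | inr c => (c == k)%:R end.
have Px a : (xvar F a).@[P] = (a == i)%:R.
  by rewrite mevalXU /P (unsplitK (inl _)) (unsplitK (inl _)).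
have Py b : (yvar F b).@[P] = (b == j)%:R.
  by rewrite mevalXU /P (unsplitK (inl _)) (unsplitK (inr _)).
have Pz c : (zvar F c).@[P] = (c == k)%:R.
  by rewrite mevalXU /P (unsplitK (inr _)).
have PAE C : (PA C).@[P] = C i j k.
  rewrite /PA raddf_sum -[RHS](sum_mulr_delta (fun a => C a j k)); apply: eq_bigr => a _.
  rewrite raddf_sum -[C a j k](sum_mulr_delta (fun b => C a b k)) mulr_suml.
  apply: eq_bigr => b _ /=; rewrite raddf_sum -[C a b k](sum_mulr_delta (fun c => C a b c)).
  rewrite !mulr_suml; apply: eq_bigr => c _ /=.
  by rewrite mevalZ !mevalM Px Py Pz; ring.
by rewrite -PAE AB PAE.
Qed.

Lemma expressibleE (A : hypermatrix F) p q r :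
  expressible_in_format A p q r <-> has_format (A : tensor 2 2 3) p q r.
Proof.
split=> [[x [y [z [t [] ]]]] | [g [h [m [t ->]]]]].
  move=> /choice [g xg] /choice [h yh] /choice [m zm] At.
  exists (\matrix_(a, i) g a i), (\matrix_(a, i) h a i), (\matrix_(a, i) m a i), t.
  apply: PA_inj; rewrite At [RHS](form_mulT _ _ _ _ (xvar F) (yvar F) (zvar F)).
  apply: eq_bigr => a _; apply: eq_bigr => b _; apply: eq_bigr => c _.
  rewrite xg yh zm; congr (_ *: (_ * _ * _)); apply: eq_bigr => ? _; by rewrite mxE.
exists (fun a => \sum_i g a i *: xvar F i), (fun b => \sum_j h b j *: yvar F j),
  (fun c => \sum_k m c k *: zvar F k), t; split.
- by move=> a; exists (g a).
- by move=> a; exists (h a).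
- by move=> a; exists (m a).
exact: (form_mulT g h m t (xvar F) (yvar F) (zvar F)).
Qed.

(** Any format of [A] passes to [T] through the right inverses of [g], [h] and [m], and there
    conciseness bounds it. *)
Lemma Fess_mulT (A : hypermatrix F) p q r g h m (T : tensor p q r) :
  row_free g -> row_free h -> row_free m -> concise_tensor T ->
  A = mulT g h m T -> Fess A p q r.
Proof.
move=> fg fh fm cT AT; split; first by apply/expressibleE; exists g, h, m, T.
move=> p' q' r' /expressibleE [e [f [l [t At]]]].
have [g' [h' [m' inv]]] := mulT_inverse fg fh fm.
apply: (concise_format cT); rewrite (inv T) -AT At mulTA.
by do 4!eexists.
Qed.

Lemma Fess_unique (A : hypermatrix F) p q r p' q' r' :
  Fess A p q r -> Fess A p' q' r' -> [/\ p = p', q = q' & r = r'].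
Proof.
move=> [A1 m1] [A2 m2]; have [? ? ?] := m1 _ _ _ A2; have [? ? ?] := m2 _ _ _ A1.
by split; apply/eqP; rewrite eqn_leq; apply/andP.
Qed.

Lemma decomposes_format p q r (T : tensor p q r) s :
  decomposes T s -> has_format T s s s.
Proof. by case=> a [b [c ->]]; do 4!eexists. Qed.

(** The source of the lower bounds on tensor ranks; only case 3a needs more. *)
Lemma Fess_tensor_rank (A : hypermatrix F) p q r s :
  Fess A p q r -> sum_of_decomposables A s -> [/\ p <= s, q <= s & r <= s]%N.
Proof.
by case=> _ minA /sum_of_decomposablesE/decomposes_format/expressibleE/minA.
Qed.

End Tensors.

(** * Linear forms and their zeros *)

Section LinearForms.
Variables (F : fieldType) (n : nat).
Implicit Types (c : 'I_n -> F) (P : 'I_n -> F).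

Definition linform c : {mpoly F[n]} := \sum_i c i *: 'X_i.

Lemma linform_homog c : linform c \is 1.-homog.
Proof. by apply: rpred_sum => i _; apply: rpredZ; rewrite dhomogX /= mdeg1. Qed.

Lemma linform_coef c i : (linform c)@_U_(i) = c i.
Proof.
rewrite raddf_sum (bigD1 i) //= mcoeffZ mcoeffXU eqxx mulr1 big1 ?addr0 // => j ji.
by rewrite mcoeffZ mcoeffXU (negPf ji) mulr0.
Qed.

Lemma homog1_linform (l : {mpoly F[n]}) : l \is 1.-homog -> exists c, l = linform c.
Proof.
move=> lh; exists (fun i => l@_U_(i)); apply/mpolyP => m.
have [/mdeg1P [i /eqP ->]|m1] := boolP (mdeg m == 1%N); first by rewrite linform_coef.
by rewrite (dhomog_nemf_coeff lh) // (dhomog_nemf_coeff (linform_homog _)).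
Qed.

Lemma meval_linform c P : (linform c).@[P] = \sum_i c i * P i.
Proof. by rewrite raddf_sum; apply: eq_bigr => i _ /=; rewrite mevalZ mevalXU. Qed.

Lemma mderiv_linform c j : (linform c)^`M(j) = (c j)%:MP.
Proof.
rewrite raddf_sum (bigD1 j) //= big1 ?addr0 => [|i ij].
  rewrite mderivZ mderivX mnmE eqxx scale1r -mul_mpolyC.
  by rewrite (_ : U_(j) - U_(j) = 0)%MM ?mpolyX0 ?mulr1 //; apply/mnmP=> i; rewrite mnmBE subnn mnm0E.
by rewrite mderivZ mderivX mnmE (negPf ij) scale0r scaler0.
Qed.

Lemma linform_eq0 c : (linform c == 0) = [forall i, c i == 0].
Proof.
apply/eqP/forallP => [l0 i|c0]; first by rewrite -linform_coef l0 mcoeff0.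
by apply: big1 => i _; rewrite (eqP (c0 i)) scale0r.
Qed.

(* The coefficients of the two forms have vanishing 2x2 minors: test on the
   points [c i * e_j - c j * e_i] of the first hyperplane. *)
Lemma linform_vanishing_proportional c d : linform c != 0 ->
  (forall P, proj_point P -> (linform c).@[P] = 0 -> (linform d).@[P] = 0) ->
  exists a, linform d = a *: linform c.
Proof.
rewrite linform_eq0 negb_forall => /existsP [i ci] cd; exists (d i / c i).
suff dE j : d j = d i / c i * c j.
  by rewrite /linform scaler_sumr; apply: eq_bigr => j _; rewrite scalerA -dE.
have [->|ji] := eqVneq j i; first by rewrite divfK.
pose P k := c i * (k == j)%:R - c j * (k == i)%:R.
have evP e : (linform e).@[P] = c i * e j - c j * e i.
  rewrite meval_linform (bigD1 j) //= (bigD1 i) ?(eq_sym i) //= big1 => [|k /andP [kj ki]].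
    by rewrite /P !eqxx (negPf ji) (eq_sym i) (negPf ji) addr0 /= mulr0n mulr1n; ring.
  by rewrite /P (negPf kj) (negPf ki) /= mulr0n; ring.
have : (linform d).@[P] = 0.
  apply: cd; last by rewrite evP; ring.
  by exists j; rewrite /P eqxx (negPf ji) mulr0 subr0 mulr1.
rewrite evP => /eqP; rewrite subr_eq0 => /eqP cd'.
by apply: (mulfI ci); rewrite cd'; field.
Qed.

End LinearForms.

(** * Ideals, saturations and projective schemes *)

Section Schemes.
Variables (F : fieldType) (n : nat).
Implicit Types (f g h l : {mpoly F[n]}) (gs hs : seq {mpoly F[n]}) (P : 'I_n -> F).

Lemma in_idealM gs f g : in_ideal gs f -> in_ideal gs (g * f).
Proof.
case=> c ->; exists (fun i => g * c i); rewrite mulr_sumr.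
by apply: eq_bigr => i _; rewrite mulrA.
Qed.

Lemma in_idealD gs f g : in_ideal gs f -> in_ideal gs g -> in_ideal gs (f + g).
Proof.
move=> [c ->] [d ->]; exists (fun i => c i + d i); rewrite -big_split.
by apply: eq_bigr => i _; rewrite mulrDl.
Qed.

Lemma in_ideal0 gs : in_ideal gs 0.
Proof. by exists (fun=> 0); rewrite big1 // => i _; rewrite mul0r. Qed.

Lemma in_ideal_sum I (r : seq I) (Q : pred I) gs (f : I -> {mpoly F[n]}) :
  (forall i, Q i -> in_ideal gs (f i)) -> in_ideal gs (\sum_(i <- r | Q i) f i).
Proof.
move=> gsf; elim/big_rec: _ => [|i x Qi]; first exact: in_ideal0.
by apply: in_idealD; apply: gsf.
Qed.

Lemma in_idealZ gs (a : F) f : in_ideal gs f -> in_ideal gs (a *: f).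
Proof. by rewrite -mul_mpolyC; apply: in_idealM. Qed.

Lemma mem_in_ideal gs g : g \in gs -> in_ideal gs g.
Proof.
move=> ggs; have lt : (index g gs < size gs)%N by rewrite index_mem.
exists (fun i => (i == Ordinal lt)%:R); rewrite (bigD1 (Ordinal lt)) //=.
rewrite eqxx mul1r nth_index // big1 ?addr0 // => i /negPf ->.
by rewrite mul0r.
Qed.

Lemma in_ideal1 h f : in_ideal [:: h] f <-> exists c, f = c * h.
Proof.
split=> [[c ->]|[c ->]]; first by exists (c ord0); rewrite big_ord1.
by exists (fun=> c); rewrite big_ord1.
Qed.

Lemma sub_ideal gs hs f : (forall g, g \in gs -> in_ideal hs g) ->
  in_ideal gs f -> in_ideal hs f.
Proof.
move=> gshs [c ->]; apply: in_ideal_sum => i _; apply: in_idealM.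
by apply: gshs; apply: mem_nth.
Qed.

Lemma vanish_ideal gs f P : in_ideal gs f -> (forall g, g \in gs -> g.@[P] = 0) ->
  f.@[P] = 0.
Proof.
move=> [c ->] gsP; rewrite raddf_sum big1 //= => i _.
by rewrite mevalM (gsP _ (mem_nth 0 (ltn_ord i))) mulr0.
Qed.

Lemma in_saturation_monomials gs f k :
  (forall m : 'X_{1..n}, mdeg m = k -> in_ideal gs ('X_[m] * f)) -> in_saturation gs f.
Proof.
move=> H; exists k => h hk; rewrite [h]mpolyE mulr_suml big_seq.
apply: in_ideal_sum => m mh; rewrite -scalerAl; apply/in_idealZ/H.
exact: (dhomog_mf hk).
Qed.

Lemma ideal_in_saturation gs f : in_ideal gs f -> in_saturation gs f.
Proof. by move=> gsf; exists 0%N => h _; apply: in_idealM. Qed.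

(* Every monomial of degree [k.+1] is a variable times one of degree [k]. *)
Lemma same_scheme_crit gs hs :
  (forall g, g \in gs -> in_ideal hs g) ->
  (forall h i, h \in hs -> in_ideal gs ('X_i * h)) -> same_scheme gs hs.
Proof.
move=> gshs hsgs f; split=> [[k kf]|[k kf]].
  by exists k => h hk; apply: sub_ideal gshs _; apply: kf.
apply: (@in_saturation_monomials _ _ k.+1) => m mk.
have [i mi] : exists i, (0 < m i)%N.
  case: (pickP (fun i => 0 < m i)%N) => [i|m0]; first by exists i.
  by move: mk; rewrite mdegE big1 // => i _; apply/eqP; rewrite -leqn0 leqNgt m0.
have mE : m = (U_(i) + (m - U_(i)))%MM.
  apply/mnmP => j; rewrite mnmDE mnmBE mnmE.
  by case: eqP => [<-|_]; rewrite ?subn0 // subnKC.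
have mk' : mdeg (m - U_(i)) = k.
  by move: mk; rewrite {1}mE mdegD mdeg1 add1n => -[].
rewrite mE mpolyXD -mulrA; case: (kf 'X_[m - U_(i)]) => [|c ->].
  by rewrite dhomogX /= mk'.
rewrite mulr_sumr; apply: in_ideal_sum => j _; rewrite mulrCA.
by apply: in_idealM; apply: hsgs; apply: mem_nth.
Qed.

(** One pure power is enough for later use: it cancels in the polynomial ring, and it does not
    vanish at a point whose coordinate [i] is nonzero. *)
Lemma saturation_pure_power gs f i : in_saturation gs f ->
  exists m, in_ideal gs ('X_i ^+ m * f).
Proof.
case=> m mf; exists m; apply: mf.
by rewrite mpolyXn dhomogX /= mdegMn mdeg1 mul1n.
Qed.

Lemma saturation_vanish gs f P : in_saturation gs f -> proj_point P ->
  (forall g, g \in gs -> g.@[P] = 0) -> f.@[P] = 0.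
Proof.
move=> fs [i Pi] gsP; have [m fi] := saturation_pure_power i fs.
have := vanish_ideal fi gsP; rewrite mevalM rmorphXn /= mevalXU => /eqP.
by rewrite mulf_eq0 expf_eq0 (negPf Pi) andbF => /eqP.
Qed.

Lemma saturation0 (i : 'I_n) f : in_saturation [:: 0] f -> f = 0.
Proof.
move=> /(saturation_pure_power i) [m /in_ideal1 [c]].
rewrite mulr0 => /eqP; rewrite mulf_eq0 expf_eq0 => /orP [/andP [_ /eqP X0]|/eqP //].
have := @mcoeffXU n F i i; rewrite X0 mcoeff0 eqxx => /eqP.
by rewrite eq_sym oner_eq0.
Qed.

Lemma same_scheme_mem gs hs h : same_scheme gs hs -> h \in hs -> in_saturation gs h.
Proof. by move=> gh hh; apply/gh/ideal_in_saturation/mem_in_ideal. Qed.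

(** Only zero sets matter: [l] vanishes wherever [l1] or [l2] does, hence is proportional to both,
    which makes [l1] a multiple of [l2]. The exponent [k.+1] covers reduced and double hyperplanes
    together. *)
Lemma not_linform_and_product gs l l1 l2 (k : nat) :
  l \is 1.-homog -> l != 0 -> l1 \is 1.-homog -> l2 \is 1.-homog -> l2 != 0 ->
  (forall c : F, l1 != c *: l2) ->
  same_scheme gs [:: l ^+ k.+1] -> ~ same_scheme gs [:: l1 * l2].
Proof.
move=> /homog1_linform [c ->] c0 /homog1_linform [c1 ->] /homog1_linform [c2 ->].
move=> c20 c12 s1 s2.
have c10 : linform c1 != 0 by have := c12 0; rewrite scale0r.
have ls : in_saturation [:: linform c1 * linform c2] (linform c ^+ k.+1).
  by apply/s2/(same_scheme_mem s1); rewrite mem_head.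
have van P : proj_point P -> (linform c1).@[P] = 0 \/ (linform c2).@[P] = 0 ->
    (linform c).@[P] = 0.
  move=> P0 cP; have : (linform c ^+ k.+1).@[P] = 0.
    apply: (saturation_vanish ls) => // g; rewrite inE => /eqP ->.
    by rewrite mevalM; case: cP => ->; rewrite ?mul0r ?mulr0.
  by rewrite rmorphXn /= => /eqP; rewrite expf_eq0 => /eqP.
have [|a1 cE1] := linform_vanishing_proportional (d := c) c10.
  by move=> P P0 ?; apply: van; auto.
have [|a2 cE2] := linform_vanishing_proportional (d := c) c20.
  by move=> P P0 ?; apply: van; auto.
have a10 : a1 != 0 by apply: contraNneq c0 => a10; rewrite cE1 a10 scale0r.
move: (c12 (a1^-1 * a2)); rewrite -scalerA -cE2 cE1 scalerA mulVf //.
by rewrite scale1r eqxx.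
Qed.

Lemma not_whole_and_nonzero (i : 'I_n) gs h :
  same_scheme gs [:: h] -> h != 0 -> ~ is_whole_space gs.
Proof.
move=> gh h0 g0; move/eqP: h0; apply; apply: (saturation0 i).
by apply/g0/(same_scheme_mem gh); rewrite mem_head.
Qed.

Lemma zero_gens_whole gs : (forall g, g \in gs -> g = 0) -> is_whole_space gs.
Proof.
move=> gs0; apply: same_scheme_crit => [g /gs0 ->|h i]; first exact: in_ideal0.
by rewrite inE => /eqP ->; rewrite mulr0; apply: in_ideal0.
Qed.

End Schemes.

(* At a common zero of [l1] and [l2], all derivatives of [c * l1 * l2] vanish,
   hence those of any [f] with ['X_i ^+ m * f = c * (l1 * l2)]. *)
Lemma smooth_not_product (F : fieldType) n (f l1 l2 : {mpoly F[n]}) :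
  (2 < n)%N -> l1 \is 1.-homog -> l2 \is 1.-homog ->
  is_smooth_hypersurface f -> ~ same_scheme [:: f] [:: l1 * l2].
Proof.
move=> n2 /homog1_linform [c1 ->] /homog1_linform [c2 ->] [_ smooth] fs.
pose E (a : 'I_2) := if a == 0 then c1 else c2.
have [P [P0 EP]] := exists_orthogonal_vector E n2.
have z1 : (linform c1).@[P] = 0 by rewrite meval_linform; apply: (EP 0).
have z2 : (linform c2).@[P] = 0 by rewrite meval_linform; apply: (EP 1).
have [i Pi] := P0.
have [|m /in_ideal1 [c fE]] := @saturation_pure_power _ _ [:: linform c1 * linform c2] f i.
  by apply/fs/ideal_in_saturation/mem_in_ideal; rewrite mem_head.
have f0 : f.@[P] = 0.
  have := congr1 (meval P) fE; rewrite !mevalM rmorphXn /= mevalXU z1 mul0r mulr0 => /eqP.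
  by rewrite mulf_eq0 expf_eq0 (negPf Pi) andbF => /eqP.
have [j /eqP []] := smooth P P0 f0.
have := congr1 (fun g => (g^`M(j)).@[P]) fE.
rewrite !mderivM !mevalD !mevalM rmorphXn /= mevalXU f0 z1 z2 !(mulr0, mul0r, add0r, addr0).
by rewrite mevalD !mevalM z1 z2 mulr0 mul0r addr0 mulr0 => /eqP; rewrite mulf_eq0 expf_eq0 (negPf Pi) andbF => /eqP.
Qed.

(** * Maximal minors of matrices with two rows *)

Section TwoRowMinors.
Variables (F : fieldType) (n v : nat).
Implicit Types (B : 'M[{mpoly F[n]}]_(2, v)).

Definition minor B k l : {mpoly F[n]} := B 0 k * B 1 l - B 0 l * B 1 k.

Lemma max_minorsP B g :
  reflect (exists k l : 'I_v, (k < l)%N /\ g = minor B k l) (g \in max_minors B).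
Proof.
apply: (iffP mapP) => [[s]|[k [l [kl ->]]]].
  rewrite mem_enum inE => /forallP s_inc ->; exists (s 0), (s 1).
  have /forallP/(_ 1)/implyP s01 := s_inc 0.
  by split; [exact: s01 | rewrite det2E !mxE].
exists [ffun i => if i == 0 then k else l]; last by rewrite det2E !mxE !ffunE.
by rewrite mem_enum inE; apply/forallP; elim/ord2P; apply/forallP; elim/ord2P;
  rewrite !ffunE.
Qed.

Lemma minor_in_ideal B k l : in_ideal (max_minors B) (minor B k l).
Proof.
have [kl|lk|/val_inj ->] := ltngtP k l.
- by apply/mem_in_ideal/max_minorsP; exists k, l.
- have -> : minor B k l = (- 1) *: minor B l k by rewrite scaleN1r /minor; ring.
  by apply/in_idealZ/mem_in_ideal/max_minorsP; exists l, k.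
- by rewrite /minor subrr; apply: in_ideal0.
Qed.

End TwoRowMinors.

(** * The matrices L, M, N, isotropic pairs and tangency to the Segre variety *)

Section Hypermatrix.
Variable F : fieldType.
Implicit Types (A B : hypermatrix F) (x y : 'I_2 -> F) (z : 'I_3 -> F).

Lemma LmxE A j k : Lmx A j k = linform (fun i => A i j k).
Proof. by rewrite mxE. Qed.

Lemma MmxE A i k : Mmx A i k = linform (fun j => A i j k).
Proof. by rewrite mxE. Qed.

Lemma NmxE A i j : Nmx A i j = linform (A i j).
Proof. by rewrite mxE. Qed.

Lemma det_NmxE A : \det (Nmx A) =
  linform (A 0 0) * linform (A 1 1) - linform (A 0 1) * linform (A 1 0).
Proof. by rewrite det2E !NmxE. Qed.

Definition slice A z i j := \sum_k A i j k * z k.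

Lemma meval_det_Nmx A z : (\det (Nmx A)).@[z] =
  slice A z 0 0 * slice A z 1 1 - slice A z 0 1 * slice A z 1 0.
Proof. by rewrite det_NmxE mevalB !mevalM !meval_linform. Qed.

Lemma mderiv_det_Nmx A z k : ((\det (Nmx A))^`M(k)).@[z] =
  A 0 0 k * slice A z 1 1 + slice A z 0 0 * A 1 1 k
  - (A 0 1 k * slice A z 1 0 + slice A z 0 1 * A 1 0 k).
Proof.
by rewrite det_NmxE mderivB !mderivM mevalB !mevalD !mevalM !mderiv_linform !mevalC !meval_linform.
Qed.

Definition isotropic A x y : Prop :=
  [/\ proj_point x, proj_point y & forall k, \sum_i \sum_j A i j k * (x i * y j) = 0].

Definition singular_triple A x y z : Prop :=
  [/\ forall k, \sum_i \sum_j A i j k * (x i * y j) = 0,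
      forall j, \sum_i \sum_k A i j k * (x i * z k) = 0
    & forall i, \sum_j \sum_k A i j k * (y j * z k) = 0].

Lemma singular_triple_slice A x y z : singular_triple A x y z ->
  (forall j, x 0 * slice A z 0 j + x 1 * slice A z 1 j = 0) /\
  (forall i, slice A z i 0 * y 0 + slice A z i 1 * y 1 = 0).
Proof.
case=> _ xz yz; split=> [j|i].
  rewrite -[RHS](xz j) sum2 !mulr_sumr.
  by congr (_ + _); apply: eq_bigr => k _; ring.
rewrite -[RHS](yz i) sum2 !mulr_suml.
by congr (_ + _); apply: eq_bigr => k _; ring.
Qed.

(* [z] solves two linear equations: of [x^T N(z) = 0] and [N(z) y = 0] one
   component each is redundant, because [x^T N(z) y = 0]. *)
Lemma isotropic_singular A x y : isotropic A x y ->
  exists z, proj_point z /\ singular_triple A x y z.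
Proof.
case=> [[i xi] [j yj] xy].
pose i' : 'I_2 := rev_ord i; pose j' : 'I_2 := rev_ord j.
pose E (a : 'I_2) k := if a == 0 then \sum_j A i' j k * y j else \sum_i A i j' k * x i.
have [z [z0 Ez]] := exists_orthogonal_vector E isT.
have sum2r (a : 'I_2) (f : 'I_2 -> F) : \sum_b f b = f a + f (rev_ord a).
  move: a; elim/ord2P; rewrite sum2; last rewrite addrC; congr (_ + f _); exact: val_inj.
have Exy : \sum_a \sum_b slice A z a b * (x a * y b) = 0.
  transitivity (\sum_k z k * \sum_a \sum_b A a b k * (x a * y b)).
    under [RHS]eq_bigr => k _ do rewrite mulr_sumr.
    rewrite [RHS]exchange_big; apply: eq_bigr => a _.
    under [RHS]eq_bigr => k _ do rewrite mulr_sumr.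
    rewrite [RHS]exchange_big; apply: eq_bigr => b _.
    by rewrite mulr_suml; apply: eq_bigr => k _; ring.
  by rewrite big1 // => k _; rewrite xy mulr0.
have yE a : \sum_b \sum_k A a b k * (y b * z k) = \sum_b slice A z a b * y b.
  by apply: eq_bigr => b _; rewrite mulr_suml; apply: eq_bigr => k _; ring.
have xE b : \sum_a \sum_k A a b k * (x a * z k) = \sum_a slice A z a b * x a.
  by apply: eq_bigr => a _; rewrite mulr_suml; apply: eq_bigr => k _; ring.
have yi' : \sum_b slice A z i' b * y b = 0.
  rewrite -[RHS](Ez 0) /E /=; under [RHS]eq_bigr => k _ do rewrite mulr_suml.
  rewrite [RHS]exchange_big; apply: eq_bigr => b _; rewrite mulr_suml.
  by apply: eq_bigr => k _; ring.
have xj' : \sum_a slice A z a j' * x a = 0.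
  rewrite -[RHS](Ez 1) /E /=; under [RHS]eq_bigr => k _ do rewrite mulr_suml.
  rewrite [RHS]exchange_big; apply: eq_bigr => b _; rewrite mulr_suml.
  by apply: eq_bigr => k _; ring.
have yi : \sum_b slice A z i b * y b = 0.
  apply: (mulfI xi); rewrite mulr0 -[RHS]Exy [RHS](sum2r i) -[LHS]addr0; congr (_ + _).
    by rewrite mulr_sumr; apply: eq_bigr => b _; ring.
  rewrite -[LHS](mulr0 (x i')) -[X in x i' * X]yi' mulr_sumr.
  by apply: eq_bigr => b _; ring.
have xj : \sum_a slice A z a j * x a = 0.
  apply: (mulfI yj); rewrite mulr0 -[RHS]Exy [X in _ = X]exchange_big [RHS](sum2r j) -[LHS]addr0; congr (_ + _).
    by rewrite mulr_sumr; apply: eq_bigr => b _; ring.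
  rewrite -[LHS](mulr0 (y j')) -[X in y j' * X]xj' mulr_sumr.
  by apply: eq_bigr => b _; ring.
have two (a c : 'I_2) : c = a \/ c = rev_ord a.
  by move: a c; elim/ord2P; elim/ord2P; [left|right|right|left]; apply: val_inj.
exists z; split=> //; split=> // [b|a].
- by rewrite xE; case: (two j b) => ->.
- by rewrite yE; case: (two i a) => ->.
Qed.

(** A tangent vector depends linearly on three free vectors [x1], [y1], [z1]. Pairing it with [A]
    gives a linear form in them whose coefficients are the left sides of the three families of
    equations; basis vectors extract these coefficients. *)
Lemma singular_triple_tangent A x y z : singular_triple A x y z <->
  (forall w, segre_tangent x y z w -> in_hyperplane A w).
Proof.
have hypE u (s : 'I_2 -> F) (t : 'I_2 -> F) (r : 'I_3 -> F) :
  (forall i j k, u i j k = s i * t j * r k) -> in_hyperplane A u <->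
  \sum_i \sum_j \sum_k A i j k * (s i * t j * r k) = 0.
  move=> uE; rewrite /in_hyperplane.
  by under eq_bigr => i _ do under eq_bigr => j _ do under eq_bigr => k _ do rewrite uE.
split=> [[xy xz yz] w [x1 [y1 [z1 wE]]]|H].
  rewrite /in_hyperplane.
  transitivity (\sum_i x1 i * (\sum_j \sum_k A i j k * (y j * z k)) +
    (\sum_j y1 j * (\sum_i \sum_k A i j k * (x i * z k)) +
     \sum_k z1 k * (\sum_i \sum_j A i j k * (x i * y j)))); last first.
    by rewrite !big1 ?addr0 // => ? _; rewrite ?xy ?xz ?yz mulr0.
  under [X in _ = _ + (X + _)]eq_bigr => j _ do rewrite mulr_sumr.
  rewrite [X in _ = _ + (X + _)]exchange_big.
  under [X in _ = _ + (_ + X)]eq_bigr => j _ do rewrite mulr_sumr.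
  rewrite [X in _ = _ + (_ + X)]exchange_big -!big_split; apply: eq_bigr => i _ /=.
  under [X in _ = _ + (_ + X)]eq_bigr => j _ do rewrite mulr_sumr.
  rewrite mulr_sumr [X in _ = _ + (_ + X)]exchange_big -!big_split; apply: eq_bigr => j _ /=.
  rewrite !mulr_sumr -!big_split; apply: eq_bigr => k _ /=.
  by rewrite wE; ring.
split=> [k|j|i].
- have := H (fun i j l => x i * y j * (l == k)%:R); rewrite (hypE _ x y (fun l => (l == k)%:R)) //.
  move=> E; rewrite -[RHS]E.
    apply: eq_bigr => i _; apply: eq_bigr => j _; under [RHS]eq_bigr do rewrite mulrA.
    by rewrite (sum_mulr_delta (fun l => A i j l * (x i * y j))).
  by exists (fun=> 0), (fun=> 0), (fun l => (l == k)%:R) => *; ring.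
- have := H (fun i b k => x i * (b == j)%:R * z k); rewrite (hypE _ x (fun b => (b == j)%:R) z) //.
  move=> E; rewrite -[RHS]E.
    apply: eq_bigr => i _; rewrite exchange_big; apply: eq_bigr => k _ /=.
    under [RHS]eq_bigr do rewrite mulrAC mulrA.
    by rewrite (sum_mulr_delta (fun l => A i l k * (x i * z k))).
  by exists (fun=> 0), (fun b => (b == j)%:R), (fun=> 0) => *; ring.
- have := H (fun b j k => (b == i)%:R * y j * z k); rewrite (hypE _ (fun b => (b == i)%:R) y z) //.
  move=> E; rewrite -[RHS]E.
    rewrite [RHS]exchange_big; apply: eq_bigr => j _ /=.
    rewrite [RHS]exchange_big; apply: eq_bigr => k _ /=.
    rewrite -(sum_mulr_delta (fun l => A l j k * (y j * z k)) i).
    by apply: eq_bigr => *; ring.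
  by exists (fun b => (b == i)%:R), (fun=> 0), (fun=> 0) => *; ring.
Qed.

End Hypermatrix.

(** * Consequences of a singular triple, and the discriminant of det N *)

Section Singular.
Variable F : fieldType.
Implicit Types (A B : hypermatrix F) (x y : 'I_2 -> F) (z : 'I_3 -> F).

(* [x^T n = 0] and [n y = 0] make the adjugate of [n] proportional to [y x^T]. *)
Lemma adjugate_pairing_eq0 x y (n a : 'I_2 -> 'I_2 -> F) :
  proj_point x -> proj_point y ->
  (forall j, x 0 * n 0 j + x 1 * n 1 j = 0) ->
  (forall i, n i 0 * y 0 + n i 1 * y 1 = 0) ->
  \sum_i \sum_j a i j * (x i * y j) = 0 ->
  a 0 0 * n 1 1 + n 0 0 * a 1 1 - (a 0 1 * n 1 0 + n 0 1 * a 1 0) = 0.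
Proof.
move=> [i xi] [j yj] xn ny; rewrite !sum2.
have x0 := xn 0; have x1 := xn 1; have y0 := ny 0; have y1 := ny 1.
set S := _ + _ => S0; set G := _ - _.
suff [i' [j' [c]]] : exists i' j', [/\ x i' != 0, y j' != 0 & x i' * y j' * G = 0].
  by move=> yj' /eqP; rewrite !mulf_eq0 (negPf c) (negPf yj') => /eqP.
exists i, j; split=> //; move: i j {xi yj}.
elim/ord2P; elim/ord2P.
- transitivity (n 1 1 * S + a 1 1 * (y 0 * (x 0 * n 0 0 + x 1 * n 1 0) - x 1 * (n 1 0 * y 0 + n 1 1 * y 1))
    - a 1 0 * (y 0 * (x 0 * n 0 1 + x 1 * n 1 1)) - a 0 1 * (x 0 * (n 1 0 * y 0 + n 1 1 * y 1))).
    by rewrite /G /S; ring.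
  by rewrite S0 x0 x1 y1; ring.
- transitivity (- n 1 0 * S + a 0 0 * (x 0 * (n 1 0 * y 0 + n 1 1 * y 1))
    + a 1 1 * (y 1 * (x 0 * n 0 0 + x 1 * n 1 0))
    - a 1 0 * (y 1 * (x 0 * n 0 1 + x 1 * n 1 1) - x 1 * (n 1 0 * y 0 + n 1 1 * y 1))).
    by rewrite /G /S; ring.
  by rewrite S0 x0 x1 y1; ring.
- transitivity (- n 0 1 * S + a 0 0 * (y 0 * (x 0 * n 0 1 + x 1 * n 1 1))
    + a 1 1 * (x 1 * (n 0 0 * y 0 + n 0 1 * y 1))
    - a 0 1 * (y 0 * (x 0 * n 0 0 + x 1 * n 1 0) - x 0 * (n 0 0 * y 0 + n 0 1 * y 1))).
    by rewrite /G /S; ring.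
  by rewrite S0 x0 x1 y0; ring.
- transitivity (n 0 0 * S + a 0 0 * (y 1 * (x 0 * n 0 1 + x 1 * n 1 1) - x 0 * (n 0 0 * y 0 + n 0 1 * y 1))
    - a 1 0 * (x 1 * (n 0 0 * y 0 + n 0 1 * y 1)) - a 0 1 * (y 1 * (x 0 * n 0 0 + x 1 * n 1 0))).
    by rewrite /G /S; ring.
  by rewrite S0 x0 x1 y0; ring.
Qed.

Lemma kernel_det0 x (n : 'I_2 -> 'I_2 -> F) : proj_point x ->
  (forall j, x 0 * n 0 j + x 1 * n 1 j = 0) -> n 0 0 * n 1 1 - n 0 1 * n 1 0 = 0.
Proof.
move=> [i xi] xn; apply: (mulfI xi); rewrite mulr0.
have x0 := xn 0; have x1 := xn 1; move: i {xi}; elim/ord2P.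
- transitivity (n 1 1 * (x 0 * n 0 0 + x 1 * n 1 0) - n 1 0 * (x 0 * n 0 1 + x 1 * n 1 1)).
    by ring.
  by rewrite x0 x1; ring.
- transitivity (n 0 0 * (x 0 * n 0 1 + x 1 * n 1 1) - n 0 1 * (x 0 * n 0 0 + x 1 * n 1 0)).
    by ring.
  by rewrite x0 x1; ring.
Qed.

(** By Jacobi's formula the derivative pairs slice [k] with the adjugate of N(z), so that
    [adjugate_pairing_eq0] turns the equation in [x] and [y] into its vanishing. *)
Lemma singular_triple_det_gradient A x y z : proj_point x -> proj_point y ->
  singular_triple A x y z -> forall k, ((\det (Nmx A))^`M(k)).@[z] = 0.
Proof.
move=> x0 y0 sA k; have [xn ny] := singular_triple_slice sA; have [xy _ _] := sA.
rewrite mderiv_det_Nmx.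
exact: (adjugate_pairing_eq0 (a := fun i j => A i j k) x0 y0 xn ny (xy k)).
Qed.

Lemma singular_triple_degenerate_Nmx A x y z :
  proj_point x -> proj_point y -> proj_point z ->
  singular_triple A x y z -> degenerate_scheme (Nmx A).
Proof.
move=> x0 y0 z0 sA; have [xn _] := singular_triple_slice sA.
have minorE g : g \in max_minors (Nmx A) -> g = \det (Nmx A).
  case/max_minorsP => k [l [+ ->]]; move: k l; elim/ord2P; elim/ord2P => // _.
  by rewrite /minor det2E.
exists z; split=> // [g /minorE ->|].
  by rewrite meval_det_Nmx (kernel_det0 x0 xn).
(* For a square matrix of size 2 in three variables the rank bound is min{1, 3} = 1, so the Jacobian
   has to vanish. *)
rewrite (_ : jacobian _ _ = 0) ?mxrank0 //; apply/matrixP => i j; rewrite !mxE.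
rewrite (minorE _ (mem_nth 0 (ltn_ord i))).
exact: singular_triple_det_gradient sA j.
Qed.

(* Euler's identity: the Jacobian of quadratic forms kills their common zero. *)
Lemma binary_minors_degenerate (B : 'M[{mpoly F[2]}]_(2, 3)) (b : 'I_2 -> 'I_3 -> 'I_2 -> F) x :
  (forall j k, B j k = linform (b j k)) -> proj_point x ->
  (forall g, g \in max_minors B -> g.@[x] = 0) -> degenerate_scheme B.
Proof.
move=> BE x0 Bx; exists x; split=> //.
rewrite (_ : minn _ _ = 2) // ltn_neqAle rank_leq_col andbT.
have [i xi] := x0.
apply: contra xi => /eqP rk.
have fJ : row_free (jacobian (max_minors B) x)^T by rewrite -row_leq_rank mxrank_tr rk.
apply/eqP; apply: (row_free_kill fJ) => k.
under eq_bigr do rewrite !mxE.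
case/max_minorsP: (mem_nth 0 (ltn_ord k)) => l [m [_ gE]].
have g0 := Bx _ (mem_nth 0 (ltn_ord k)); rewrite gE in g0 *.
transitivity ((minor B l m).@[x] + (minor B l m).@[x]); last by rewrite g0 addr0.
rewrite /minor !BE sum2 !mderivB !mderivM !mevalB !mevalD !mevalM.
by rewrite !mderiv_linform !mevalC !meval_linform !sum2; ring.
Qed.

(** The equations in [x] and [y] read y^T L(x) = 0, so the rows of L(x) are dependent and all its
    minors vanish. *)
Lemma singular_triple_degenerate_Lmx A x y z :
  proj_point x -> proj_point y -> singular_triple A x y z ->
  degenerate_scheme (Lmx A).
Proof.
move=> x0 y0 [xy _ _]; apply: (binary_minors_degenerate (LmxE A) x0) => g.
case/max_minorsP => k [l [_ ->]]; rewrite /minor mevalB !mevalM !LmxE !meval_linform.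
apply: (kernel_det0 (n := fun j (a : 'I_2) => \sum_i A i j (if a == 0 then k else l) * x i) y0).
move=> a /=; rewrite -[RHS](xy (if a == 0 then k else l)) !sum2; ring.
Qed.

Lemma singular_triple_degenerate_Mmx A x y z :
  proj_point x -> proj_point y -> singular_triple A x y z ->
  degenerate_scheme (Mmx A).
Proof.
move=> x0 y0 [xy _ _]; apply: (binary_minors_degenerate (MmxE A) y0) => g.
case/max_minorsP => k [l [_ ->]]; rewrite /minor mevalB !mevalM !MmxE !meval_linform.
apply: (kernel_det0 (n := fun i (a : 'I_2) => \sum_j A i j (if a == 0 then k else l) * y j) x0).
move=> a /=; rewrite -[RHS](xy (if a == 0 then k else l)) !sum2; ring.
Qed.

Lemma hyperdeterminant_tangent (D : dual_poly F) A :
  is_hyperdeterminant D -> tangent_hyperplane A -> heval D A = 0.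
Proof.
move=> hD tA; have /hD : exists g, D = g * D by exists 1; rewrite mul1r.
by apply; split; [case: tA | move=> f; apply].
Qed.

Lemma hyperdeterminant_singular (D : dual_poly F) A x y z :
  hnonzero A -> proj_point x -> proj_point y -> proj_point z ->
  singular_triple A x y z -> is_hyperdeterminant D -> heval D A = 0.
Proof.
move=> A0 x0 y0 z0 /singular_triple_tangent tA hD; apply: hyperdeterminant_tangent => //.
by split=> //; exists x, y, z.
Qed.

Definition coord (i j : 'I_2) (k : 'I_3) : dual_poly F :=
  'X_(enum_rank ((i, j, k) : hindex)).

Lemma heval_coord A i j k : heval (coord i j k) A = A i j k.
Proof. by rewrite /heval mevalXU /= enum_rankK. Qed.

(* The Gram matrix of the polar form of the quadratic form [det N(z)], as a
   matrix of polynomials in the entries of the hypermatrix. *)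
Definition hessian_poly : 'M[dual_poly F]_3 := \matrix_(k, l)
  (coord 0 0 k * coord 1 1 l + coord 0 0 l * coord 1 1 k
   - (coord 0 1 k * coord 1 0 l + coord 0 1 l * coord 1 0 k)).

Definition hessian A : 'M[F]_3 := \matrix_(k, l)
  (A 0 0 k * A 1 1 l + A 0 0 l * A 1 1 k - (A 0 1 k * A 1 0 l + A 0 1 l * A 1 0 k)).

Lemma heval_det_hessian A : heval (\det hessian_poly) A = \det (hessian A).
Proof.
rewrite /heval -det_map_mx; congr (\det _); apply/matrixP => k l; rewrite !mxE.
by rewrite rmorphB !rmorphD !rmorphM /= -!/(heval _ A) !heval_coord.
Qed.

Lemma hessian_gradient A z k :
  \sum_l z l * hessian A l k = ((\det (Nmx A))^`M(k)).@[z].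
Proof.
rewrite mderiv_det_Nmx /slice !(mulr_sumr, mulr_suml) -!big_split -sumrB.
by apply: eq_bigr => l _; rewrite mxE /=; ring.
Qed.

Lemma hessian_singular A x y z : proj_point x -> proj_point y -> proj_point z ->
  singular_triple A x y z -> \det (hessian A) = 0.
Proof.
move=> x0 y0 [i zi] sA; apply/eqP/negPn/negP => det0.
have fH : row_free (hessian A) by rewrite row_free_unit unitmxE unitfE.
move/eqP: zi; apply; apply: (row_free_kill fH) => k.
rewrite hessian_gradient; exact: singular_triple_det_gradient sA k.
Qed.

Lemma smooth_hessian A : 2%:R != 0 :> F ->
  is_smooth_hypersurface (\det (Nmx A)) -> \det (hessian A) != 0.
Proof.
move=> F2 [_ smooth]; apply/negP => det0.
have [|z [z0 Hz]] := not_row_free (v := hessian A).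
  by rewrite row_free_unit unitmxE unitfE det0.
have gz k : ((\det (Nmx A))^`M(k)).@[z] = 0 by rewrite -hessian_gradient Hz.
have [|k /eqP] := smooth z z0; last by rewrite gz.
(* Euler's identity: twice the quadratic form det N at [z] is the pairing of [z] with the
   gradient. *)
apply: (mulfI F2); rewrite mulr0.
transitivity (\sum_k z k * ((\det (Nmx A))^`M(k)).@[z]).
  under eq_bigr do rewrite mderiv_det_Nmx.
  rewrite meval_det_Nmx /slice !sum3; ring.
by rewrite big1 // => k _; rewrite gz mulr0.
Qed.

Lemma smooth_hyperdeterminant (D : dual_poly F) A : 2%:R != 0 :> F ->
  is_smooth_hypersurface (\det (Nmx A)) -> is_hyperdeterminant D -> heval D A <> 0.
Proof.
move=> F2 smooth hD D0; have /negP := smooth_hessian F2 smooth; apply; apply/eqP.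
have [|g fE] := (hD (\det hessian_poly)).1.
  (* The dual variety is a Zariski closure, so vanishing on the tangent hyperplanes themselves
     suffices. *)
  move=> B [_ dualB]; apply: dualB => B' [_ [x [y [z [x0 y0 z0 tB]]]]].
  rewrite heval_det_hessian; apply: (hessian_singular x0 y0 z0).
  exact/singular_triple_tangent.
by rewrite -heval_det_hessian fE /heval mevalM -/(heval D A) D0 mulr0.
Qed.


End Singular.

(** * Hypermatrices without isotropic pair *)

Section Anisotropic.
Variable F : closedFieldType.
Implicit Types (A B : hypermatrix F) (x y : 'I_2 -> F) (z : 'I_3 -> F).

Definition pair_of (T : Type) (a b : T) (i : 'I_2) : T := if i == 0 then a else b.

Lemma binary_quadratic_root (a b c : F) : exists y, proj_point y /\
  a * y 0 ^+ 2 + b * (y 0 * y 1) + c * y 1 ^+ 2 = 0.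
Proof.
have [->|a0] := eqVneq a 0.
  exists (pair_of 1 0); split; first by exists 0; rewrite /pair_of eqxx oner_neq0.
  by rewrite /pair_of /=; ring.
have [t tE] := solve_monicpoly (fun i => if i is 0 then - c / a else - b / a) (isT : (0 < 2)%N).
exists (pair_of t 1); split; first by exists 1; rewrite oner_neq0.
by rewrite /pair_of /= tE sum2 /=; field.
Qed.

(** The relation [z] expresses slice [k] by the other two, so two bilinear equations remain. With
    N_0 and N_1 these two slices, the determinant of N_0 y and N_1 y is a binary quadratic form in
    [y]; at a root both vectors are orthogonal to a common nonzero [x]. *)
Lemma killed3_isotropic A z : proj_point z -> killed3 A z -> exists x y, isotropic A x y.
Proof.
move=> [k zk] Az; pose a l y i := \sum_j A i j (lift k l) * y j : F.
have [y [y0 qy]] : exists y, proj_point y /\ a 0 y 0 * a 1 y 1 - a 0 y 1 * a 1 y 0 = 0.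
  pose T l i j := A i j (lift k l).
  have [y [y0 qy]] := binary_quadratic_root
    (T 0 0 0 * T 1 1 0 - T 0 1 0 * T 1 0 0)
    (T 0 0 0 * T 1 1 1 + T 0 0 1 * T 1 1 0 - T 0 1 0 * T 1 0 1 - T 0 1 1 * T 1 0 0)
    (T 0 0 1 * T 1 1 1 - T 0 1 1 * T 1 0 1).
  by exists y; split=> //; rewrite /a !sum2 -[RHS]qy /T; ring.
have [x [x0 ax]] : exists x, proj_point x /\ forall l, \sum_i a l y i * x i = 0.
  pose M := \matrix_(i, l) a l y i : 'M_2.
  have [|x [x0 xM]] := not_row_free (v := M).
    by rewrite row_free_unit unitmxE unitfE det2E !mxE mulrC [X in _ - X]mulrC -(eqP (introT eqP qy)) negbK; apply/eqP; ring.
  exists x; split=> // l; rewrite -[RHS](xM l); apply: eq_bigr => i _.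
  by rewrite mxE mulrC.
pose S l := \sum_i \sum_j A i j l * (x i * y j).
have Sl l : S (lift k l) = 0.
  rewrite -[RHS](ax l); apply: eq_bigr => i _; rewrite mulr_suml.
  by apply: eq_bigr => j _; ring.
exists x, y; split=> // l; rewrite -/(S l).
have [m ->|->] := unliftP k l; first exact: Sl.
apply: (mulfI zk); rewrite mulr0 -[LHS]addr0.
transitivity (\sum_l z l * S l).
  by rewrite (bigD1_ord k) //=; congr (_ + _); rewrite big1 // => m _; rewrite Sl mulr0.
under eq_bigr => m _ do rewrite mulr_sumr.
rewrite exchange_big big1 // => i _.
under eq_bigr => m _ do rewrite mulr_sumr.
rewrite exchange_big big1 // => j _.
by under eq_bigr => m _ do rewrite mulrA; rewrite -mulr_suml Az mul0r.
Qed.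

Lemma killed1_isotropic A x : proj_point x -> killed1 A x -> exists x y, isotropic A x y.
Proof.
move=> x0 Ax; exists x, (fun=> 1); split=> //; first by exists 0; rewrite oner_neq0.
move=> k; rewrite exchange_big big1 // => j _; rewrite -[RHS](Ax j k).
by apply: eq_bigr => i _; ring.
Qed.

Lemma killed2_isotropic A y : proj_point y -> killed2 A y -> exists x y, isotropic A x y.
Proof.
move=> y0 Ay; exists (fun=> 1), y; split=> //; first by exists 0; rewrite oner_neq0.
move=> k; rewrite big1 // => i _; rewrite -[RHS](Ay i k).
by apply: eq_bigr => j _; ring.
Qed.

(** If N(z) = 0, then [z] kills [A]. Otherwise N(z) = x y^T has rank one, its cofactor matrix is the
    product of the quarter turns of [x] and [y], and the vanishing gradient says that these turned
    vectors form an isotropic pair. *)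
Lemma gradient0_isotropic A z : proj_point z ->
  (\det (Nmx A)).@[z] = 0 -> (forall k, ((\det (Nmx A))^`M(k)).@[z] = 0) ->
  exists x y, isotropic A x y.
Proof.
move=> z0; rewrite meval_det_Nmx => d0 g0.
have [n0|] := pselect (forall i j, slice A z i j = 0).
  apply: (killed3_isotropic z0) => i j; rewrite -[RHS](n0 i j).
  by apply: eq_bigr => k _; rewrite mulrC.
move=> /existsNP [i /existsNP [j /eqP nij]].
have [|x [y [x0 y0 nE]]] := rank_one_factor d0; first by exists i, j.
have flip0 (u : 'I_2 -> F) : proj_point u -> proj_point (pair_of (u 1) (- u 0)).
  by case; elim/ord2P => u0; [exists 1; rewrite oppr_eq0 | exists 0].
exists (pair_of (x 1) (- x 0)), (pair_of (y 1) (- y 0)); split; try exact: flip0.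
move=> k; rewrite -[RHS](g0 k) mderiv_det_Nmx !nE !sum2 /pair_of /=; ring.
Qed.

Lemma anisotropic_smooth A : (~ exists x y, isotropic A x y) ->
  is_smooth_hypersurface (\det (Nmx A)).
Proof.
move=> noA; split=> [|z z0 fz].
  apply/eqP => d0; apply: noA; apply: (@gradient0_isotropic _ (fun=> 1)).
  - by exists 0; rewrite oner_neq0.
  - by rewrite d0 meval0.
  - by move=> k; rewrite d0 mderiv0 meval0.
apply/not_existsP => g0; apply: noA; apply: gradient0_isotropic z0 fz _.
by move=> k; apply/eqP/negPn/negP => /g0.
Qed.

Lemma anisotropic_concise A : (~ exists x y, isotropic A x y) -> concise A.
Proof.
move=> noA; apply: (@Fess_mulT _ A _ _ _ 1%:M 1%:M 1%:M A);
  rewrite ?row_free_unit ?unitmx1 ?mulT1 //.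
by split=> u Au i; apply/eqP/negPn/negP => ui; apply: noA;
  [apply: killed1_isotropic Au | apply: killed2_isotropic Au | apply: killed3_isotropic Au];
  exists i.
Qed.

Lemma sum_of_3_decomposables A (a0 a1 a2 b0 b1 b2 : 'I_2 -> F) (c0 c1 c2 : 'I_3 -> F) :
  (forall i j k, A i j k = a0 i * b0 j * c0 k + a1 i * b1 j * c1 k + a2 i * b2 j * c2 k) ->
  sum_of_decomposables A 3.
Proof.
move=> AE; exists (fun s : 'I_3 => nth a0 [:: a0; a1; a2] s), (fun s : 'I_3 => nth b0 [:: b0; b1; b2] s),
  (fun s : 'I_3 => nth c0 [:: c0; c1; c2] s) => i j k.
by rewrite AE sum3.
Qed.

(* The slices of [A] lie in the orthogonal of some [Q], which is invertible.
   With [w_0], [w_1] the rows of [Q] rotated by a quarter turn, that orthogonal is spanned by [e_0 w_0], [e_1 w_1] and [(e_0 + e_1) (w_0 + w_1)]. *)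
Lemma anisotropic_decomposables A : (~ exists x y, isotropic A x y) ->
  sum_of_decomposables A 3.
Proof.
move=> noA; pose E k (m : 'I_4) := nth 0 [:: A 0 0 k; A 0 1 k; A 1 0 k; A 1 1 k] m.
have [q [q0 Eq]] := exists_orthogonal_vector E isT.
pose a := q (inord 0); pose b := q (inord 1); pose c := q (inord 2); pose d := q (inord 3).
have AQ k : A 0 0 k * a + A 0 1 k * b + A 1 0 k * c + A 1 1 k * d = 0.
  rewrite -[RHS](Eq k) !big_ord_recl big_ord0 /E /= addr0 -!addrA.
  by congr (_ * q _ + (_ * q _ + (_ * q _ + _ * q _))); apply: val_inj; rewrite /= ?inordK.
have det0 : a * d - b * c != 0.
  (* A nonzero singular [Q] would factor as x y^T, and orthogonality of the slices to it would make
     (x, y) isotropic. *)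
  apply/negP => /eqP det0; apply: noA.
  pose Q (i j : 'I_2) := pair_of (pair_of a b j) (pair_of c d j) i.
  have [|x [y [x0 y0 QE]]] := @rank_one_factor _ Q det0.
    case: q0 => -[[|[|[|[|//]]]] lt4] qi.
    - by exists 0, 0; rewrite /Q /pair_of /= /a (_ : inord 0 = Ordinal lt4) //; apply: val_inj; rewrite /= inordK.
    - by exists 0, 1; rewrite /Q /pair_of /= /b (_ : inord 1 = Ordinal lt4) //; apply: val_inj; rewrite /= inordK.
    - by exists 1, 0; rewrite /Q /pair_of /= /c (_ : inord 2 = Ordinal lt4) //; apply: val_inj; rewrite /= inordK.
    - by exists 1, 1; rewrite /Q /pair_of /= /d (_ : inord 3 = Ordinal lt4) //; apply: val_inj; rewrite /= inordK.
  exists x, y; split=> // k; rewrite -[RHS](AQ k) !sum2 -!QE /Q /pair_of /=; ring.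
pose D := a * d - b * c; have D0 : D != 0 := det0.
pose w0 := pair_of (b / D) (- a / D); pose w1 := pair_of (d / D) (- c / D).
(* In the basis [w0], [w1], the second coordinate of row 0 of slice [k] equals the first coordinate
   of row 1, by [AQ]; [m k] is this common value, carried by the summand with [w0 + w1]. *)
pose m k := a * A 0 0 k + b * A 0 1 k.
apply: (@sum_of_3_decomposables _ (fun=> 1) (pair_of 1 0) (pair_of 0 1)
  (fun j => w0 j + w1 j) w0 w1 m
  (fun k => - c * A 0 0 k - d * A 0 1 k - m k)
  (fun k => a * A 1 0 k + b * A 1 1 k - m k)) => i j k.
move: i j; elim/ord2P; elim/ord2P.
- by rewrite /w0 /w1 /m /D /pair_of /=; field.
- by rewrite /w0 /w1 /m /D /pair_of /=; field.
- rewrite -[LHS]addr0 -[X in _ + X = _](mulr0 (w0 0)) -[X in _ + _ * X = _](AQ k).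
  by rewrite /w0 /w1 /m /D /pair_of /=; field.
- rewrite -[LHS]addr0 -[X in _ + X = _](mulr0 (w0 1)) -[X in _ + _ * X = _](AQ k).
  by rewrite /w0 /w1 /m /D /pair_of /=; field.
Qed.



End Anisotropic.

(** * The normal forms, their associated matrices and their conciseness *)

Section NormalForms.
Variable F : fieldType.
Implicit Types (A : hypermatrix F).

Lemma linform_sum n r (v : 'I_n -> F) (a : 'I_r -> F) (c : 'I_r -> 'I_n -> F) :
  (forall i, v i = \sum_l a l * c l i) ->
  linform v = \sum_l (a l)%:MP * linform (c l).
Proof.
move=> vE; rewrite /linform; under eq_bigr do rewrite vE scaler_suml.
rewrite exchange_big; apply: eq_bigr => l _; rewrite mul_mpolyC scaler_sumr.
by apply: eq_bigr => i _; rewrite scalerA.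
Qed.

Lemma Nmx_mulT p q r g h m (T : tensor F p q r) i j :
  Nmx (mulT g h m T) i j = \sum_c (mul1 g (mul2 h T) i j c)%:MP * linform (m c).
Proof.
rewrite NmxE; apply: linform_sum => k.
by rewrite /mulT mul23C mul13C; apply: eq_bigr => c _; rewrite mulrC.
Qed.

Lemma Lmx_mulT p q r g h m (T : tensor F p q r) j k :
  Lmx (mulT g h m T) j k = \sum_a (mul2 h (mul3 m T) a j k)%:MP * linform (g a).
Proof.
by rewrite LmxE; apply: linform_sum => i; apply: eq_bigr => a _; rewrite mulrC.
Qed.

Lemma Mmx_mulT p q r g h m (T : tensor F p q r) i k :
  Mmx (mulT g h m T) i k = \sum_b (mul1 g (mul3 m T) i b k)%:MP * linform (h b).
Proof.
rewrite MmxE; apply: linform_sum => j.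
by rewrite /mulT mul12C; apply: eq_bigr => b _; rewrite mulrC.
Qed.

Lemma row_free_linform_neq0 r n (m : 'M[F]_(r, n)) a : row_free m -> linform (m a) != 0.
Proof.
move=> fm; apply/negP; rewrite linform_eq0 => /forallP m0.
have u0 := @row_free_kill _ _ _ m (fun b => (b == a)%:R) fm _ a.
have /eqP := oner_neq0 F; apply; rewrite -[RHS]u0 ?eqxx // => k.
rewrite big1 // => b _.
by case: (eqVneq b a) => [->|_]; rewrite ?(eqP (m0 k)) ?mulr0 ?mul0r.
Qed.

Lemma row_free_linform_not_proportional r n (m : 'M[F]_(r, n)) a b (c : F) :
  row_free m -> a != b -> linform (m a) != c *: linform (m b).
Proof.
move=> fm ab; apply/eqP => E.
have u0 := @row_free_kill _ _ _ m (fun d => (d == a)%:R - c * (d == b)%:R) fm _ a.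
have : 1 - c * 0 = 0 :> F.
  rewrite -[RHS]u0 ?eqxx ?(negPf ab) // => k.
  have mE : m a k = c * m b k by rewrite -linform_coef E mcoeffZ linform_coef.
  rewrite (bigD1 a) //= (bigD1 b) 1?eq_sym //= big1 => [|d /andP [/negPf da /negPf db]].
    by rewrite !eqxx (eq_sym b) (negPf ab) mE /= mulr0n mulr1n; ring.
  by rewrite da db /= mulr0n mulr0 subr0 mul0r.
by rewrite mulr0 subr0 => /eqP; rewrite oner_eq0.
Qed.

Lemma row_free2_minor n (m : 'M[F]_(2, n)) : row_free m ->
  exists k l, m 0 k * m 1 l - m 0 l * m 1 k != 0.
Proof.
move=> fm; apply/not_existsP => m0; have mE k l : m 0 k * m 1 l - m 0 l * m 1 k = 0.
  by apply/eqP/negPn/negP => kl; apply: (m0 k); exists l.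
have m1 k : m 1 k = 0.
  apply: (@row_free_kill _ _ _ m (pair_of (m 1 k) (- m 0 k)) fm _ 0) => l.
  by rewrite sum2 /pair_of /= -[RHS](mE l k); ring.
have /eqP := oner_neq0 F; apply.
apply: (@row_free_kill _ _ _ m (pair_of 0 1) fm _ 1) => l.
by rewrite sum2 /pair_of /= m1; ring.
Qed.

Lemma same_scheme_scale n (f g : {mpoly F[n]}) (c : F) :
  c != 0 -> f = c%:MP * g -> same_scheme [:: f] [:: g].
Proof.
move=> c0 ->; apply: same_scheme_crit => [h|h i]; rewrite inE => /eqP ->.
  by apply/in_ideal1; exists c%:MP.
apply/in_idealM/in_ideal1; exists (c^-1)%:MP.
by rewrite mulrA -mpolyCM mulVf // mpolyC1 mul1r.
Qed.

(** In cases 2b, 3a and 4a the minors are scalar multiples of one form, so they generate its ideal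
    already before saturation. *)
Lemma same_scheme_minors n v (B : 'M[{mpoly F[n]}]_(2, v)) f (c : 'I_v -> 'I_v -> F) :
  (forall k l, minor B k l = (c k l)%:MP * f) -> (exists k l, c k l != 0) ->
  same_scheme (max_minors B) [:: f].
Proof.
move=> BE [k [l ckl]]; apply: same_scheme_crit => [g|h i].
  by case/max_minorsP => k' [l' [_ ->]]; apply/in_ideal1; exists (c k' l')%:MP.
rewrite inE => /eqP ->; apply: in_idealM.
have -> : f = (c k l)^-1%:MP * minor B k l.
  by rewrite BE mulrA -mpolyCM mulVf // mpolyC1 mul1r.
exact/in_idealM/minor_in_ideal.
Qed.

(* The matrices [N] of these tensors are [[z0, z1], [z2, 0]], [[z0, 0], [0, z1]],
   [[z0, z1], [z1, 0]], [[z0, 0], [0, z0]], the row and the column with entries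
   [z0, z1], and [z0]. *)
Definition tensor2a : tensor F 2 2 3 := fun a b c => if (c == b + 2 * a :> nat)%N then 1 else 0.
Definition tensor2b : tensor F 2 2 2 := fun a b c => if (a == b) && (b == c) then 1 else 0.
Definition tensor3a : tensor F 2 2 2 := fun a b c => if (c == a + b :> nat)%N then 1 else 0.
Definition tensor3b : tensor F 2 2 1 := fun a b _ => if a == b then 1 else 0.
Definition tensor4a1 : tensor F 1 2 2 := fun _ b c => if b == c then 1 else 0.
Definition tensor4a2 : tensor F 2 1 2 := fun a _ c => if a == c then 1 else 0.
Definition tensor4b : tensor F 1 1 1 := fun _ _ _ => 1.

Lemma concise_tensor2a : concise_tensor tensor2a.
Proof.
split=> u; rewrite /killed1 /killed2 /killed3 /tensor2a => H.
- have := H 0 0; have := H 0 ord_max; rewrite !sum2 /= ?mulr0 ?mulr1 ?addr0 ?add0r => u1 u0.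
  by elim/ord2P.
- have := H 0 0; have := H 0 1; rewrite !sum2 /= ?mulr0 ?mulr1 ?addr0 ?add0r => u1 u0.
  by elim/ord2P.
have := H 0 0; have := H 0 1; have := H 1 0; rewrite !sum3 /= ?mulr0 ?mulr1 ?addr0 ?add0r => u1 u2 u0.
by elim/ord3P.
Qed.

Lemma concise_tensor2b : concise_tensor tensor2b.
Proof.
split=> u; rewrite /killed1 /killed2 /killed3 /tensor2b => H;
have := H 0 0; have := H 1 1; rewrite !sum2 /= ?mulr0 ?mulr1 ?addr0 ?add0r => u1 u0;
  by elim/ord2P.
Qed.

Lemma concise_tensor3a : concise_tensor tensor3a.
Proof.
split=> u; rewrite /killed1 /killed2 /killed3 /tensor3a => H;
have := H 0 0; have := H 0 1; rewrite !sum2 /= ?mulr0 ?mulr1 ?addr0 ?add0r => u1 u0;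
  by elim/ord2P.
Qed.

Lemma concise_tensor3b : concise_tensor tensor3b.
Proof.
split=> u; rewrite /killed1 /killed2 /killed3 /tensor3b => H.
- have := H 0 0; have := H 1 0; rewrite !sum2 /= ?mulr0 ?mulr1 ?addr0 ?add0r => u1 u0; by elim/ord2P.
- have := H 0 0; have := H 1 0; rewrite !sum2 /= ?mulr0 ?mulr1 ?addr0 ?add0r => u1 u0; by elim/ord2P.
- by have := H 0 0; rewrite big_ord1 /= mulr1 => u0 k; rewrite ord1.
Qed.

Lemma concise_tensor4a1 : concise_tensor tensor4a1.
Proof.
split=> u; rewrite /killed1 /killed2 /killed3 /tensor4a1 => H.
- by have := H 0 0; rewrite big_ord1 /= mulr1 => u0 k; rewrite ord1.
- have := H 0 0; have := H 0 1; rewrite !sum2 /= ?mulr0 ?mulr1 ?addr0 ?add0r => u1 u0; by elim/ord2P.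
- have := H 0 0; have := H 0 1; rewrite !sum2 /= ?mulr0 ?mulr1 ?addr0 ?add0r => u1 u0; by elim/ord2P.
Qed.

Lemma concise_tensor4a2 : concise_tensor tensor4a2.
Proof.
split=> u; rewrite /killed1 /killed2 /killed3 /tensor4a2 => H.
- have := H 0 0; have := H 0 1; rewrite !sum2 /= ?mulr0 ?mulr1 ?addr0 ?add0r => u1 u0; by elim/ord2P.
- by have := H 0 0; rewrite big_ord1 /= mulr1 => u0 k; rewrite ord1.
- have := H 0 0; have := H 1 0; rewrite !sum2 /= ?mulr0 ?mulr1 ?addr0 ?add0r => u1 u0; by elim/ord2P.
Qed.

Lemma concise_tensor4b : concise_tensor tensor4b.
Proof.
split=> u; rewrite /killed1 /killed2 /killed3 /tensor4b => H;
  by have := H 0 0; rewrite big_ord1 /= mulr1 => u0 k; rewrite ord1.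
Qed.

End NormalForms.

(** * Each normal form satisfies the hypotheses of its case *)

Section Consequences.
Variable F : fieldType.
Implicit Types (A : hypermatrix F).

Ltac expand_minors := rewrite ?det2E /minor ?Nmx_mulT ?Lmx_mulT ?Mmx_mulT
  /mul1 /mul2 /mul3 ?(sum2, sum3, big_ord1)
  /tensor2a /tensor2b /tensor3a /tensor3b /tensor4a1 /tensor4a2 /tensor4b /=.

Section InCase.
Variables (h : 'M[F]_2).
Hypothesis fh : row_free h.
Let dh : h 0 0 * h 1 1 - h 0 1 * h 1 0 != 0 := row_free_det2 fh.

(** Here the minors of L generate the form [linform (g 0)] times the irrelevant ideal. This is
    smaller than the ideal of the point, with which it agrees only after saturation. *)
Lemma in_case_tensor2a g (m : 'M_3) : row_free g -> row_free m ->
  in_case (mulT g h m (tensor2a F)) Case2a.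
Proof.
move=> fg fm; have dg := row_free_det2 fg; split.
  exists (linform (m 1)), (linform (m ord_max)).
  rewrite !linform_homog row_free_linform_neq0 //; split=> //.
    by move=> c; apply: row_free_linform_not_proportional.
  apply: (same_scheme_scale (c := - ((g 0 0 * g 1 1 - g 0 1 * g 1 0) * (h 0 0 * h 1 1 - h 0 1 * h 1 0)))).
    by rewrite oppr_eq0 mulf_neq0.
  by expand_minors; ring.
exists (linform (g 0)); rewrite linform_homog row_free_linform_neq0 //; split=> //.
set L := Lmx _; pose M (a b k l : 'I_3) := m a k * m b l - m a l * m b k.
have LE k l : minor L k l = (h 0 0 * h 1 1 - h 0 1 * h 1 0)%:MP * linform (g 0) *
    ((M 0 1 k l)%:MP * linform (g 0) + (M ord_max 1 k l)%:MP * linform (g 1)).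
  by rewrite /L /M; expand_minors; ring.
apply: same_scheme_crit => [f|f i].
  case/max_minorsP => k [l [_ ->]]; apply/in_ideal1; rewrite LE.
  by eexists; rewrite mulrAC.
rewrite inE => /eqP ->.
have c0 : \det m * (h 0 0 * h 1 1 - h 0 1 * h 1 0) != 0.
  by rewrite mulf_neq0 // -unitfE -unitmxE -row_free_unit.
(* Laplace expansion: this combination turns each [M b c] in [LE] into the determinant of rows [a],
   [b], [c] of [m]. Row [ord_max] leaves only the term in [g 0], with [\det m]; row 0 leaves only
   the term in [g 1], with the opposite sign. *)
have cross a : in_ideal (max_minors L) ((m a 0)%:MP * minor L 1 ord_max +
    (m a 1)%:MP * minor L ord_max 0 + (m a ord_max)%:MP * minor L 0 1).
  by do ?apply: in_idealD; apply/in_idealM/minor_in_ideal.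
have gg a : in_ideal (max_minors L) (linform (g a) * linform (g 0)).
  have -> : linform (g a) * linform (g 0) = (\det m * (h 0 0 * h 1 1 - h 0 1 * h 1 0))^-1%:MP *
     ((\det m * (h 0 0 * h 1 1 - h 0 1 * h 1 0))%:MP * (linform (g a) * linform (g 0))).
    by rewrite [RHS]mulrA -mpolyCM mulVf // mpolyC1 mul1r.
  apply: in_idealM; move: a; elim/ord2P.
    by have := cross ord_max; rewrite !LE /M det3E; congr in_ideal; ring.
  have := in_idealZ (- 1) (cross 0).
  by rewrite -mul_mpolyC !LE /M det3E; congr in_ideal; ring.
(* As [g] is invertible, the variables are combinations of the two forms treated in [gg]. *)
have /row_freeP [d /mulmx1C dg1] := fg.
have -> : 'X_i = \sum_a (d i a)%:MP * linform (g a) :> {mpoly F[2]}.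
  rewrite -(linform_sum (v := fun k => (1%:M : 'M_2) i k)); last by move=> k; rewrite -dg1 mxE.
  rewrite /linform (bigD1 i) //= mxE eqxx scale1r big1 ?addr0 // => k ki.
  by rewrite mxE eq_sym (negPf ki) scale0r.
rewrite mulr_suml; apply: in_ideal_sum => a _; rewrite -mulrA.
exact: in_idealM.
Qed.

Lemma in_case_tensor2b g (m : 'M_(2, 3)) : row_free g -> row_free m ->
  in_case (mulT g h m (tensor2b F)) Case2b.
Proof.
move=> fg fm; have dg := row_free_det2 fg; split.
  exists (linform (m 0)), (linform (m 1)).
  rewrite !linform_homog row_free_linform_neq0 //; split=> //.
    by move=> c; apply: row_free_linform_not_proportional.
  apply: (same_scheme_scale (c := (g 0 0 * g 1 1 - g 0 1 * g 1 0) * (h 0 0 * h 1 1 - h 0 1 * h 1 0))).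
    by rewrite mulf_neq0.
  by expand_minors; ring.
exists (linform (g 0)), (linform (g 1)).
rewrite !linform_homog row_free_linform_neq0 //; split=> //.
  by move=> c; apply: row_free_linform_not_proportional.
have [k [l mkl]] := row_free2_minor fm.
apply: (same_scheme_minors (c := fun k l => (h 0 0 * h 1 1 - h 0 1 * h 1 0) * (m 0 k * m 1 l - m 0 l * m 1 k))).
  by move=> k' l'; expand_minors; ring.
by exists k, l; rewrite mulf_neq0.
Qed.

Lemma in_case_tensor3a g (m : 'M_(2, 3)) : row_free g -> row_free m ->
  in_case (mulT g h m (tensor3a F)) Case3a.
Proof.
move=> fg fm; have dg := row_free_det2 fg; split.
  exists (linform (m 1)).
  rewrite !linform_homog row_free_linform_neq0 //; split=> //.
  apply: (same_scheme_scale (c := - ((g 0 0 * g 1 1 - g 0 1 * g 1 0) * (h 0 0 * h 1 1 - h 0 1 * h 1 0)))).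
    by rewrite oppr_eq0 mulf_neq0.
  by expand_minors; ring.
exists (linform (g 0)).
rewrite !linform_homog row_free_linform_neq0 //; split=> //.
have [k [l mkl]] := row_free2_minor fm.
apply: (same_scheme_minors (c := fun k l => (h 0 0 * h 1 1 - h 0 1 * h 1 0) * (m 0 k * m 1 l - m 0 l * m 1 k))).
  by move=> k' l'; expand_minors; ring.
by exists k, l; rewrite mulf_neq0.
Qed.

Lemma in_case_tensor3b g (m : 'M_(1, 3)) : row_free g -> row_free m ->
  in_case (mulT g h m (tensor3b F)) Case3b.
Proof.
move=> fg fm; have dg := row_free_det2 fg; split.
  exists (linform (m 0)).
  rewrite !linform_homog row_free_linform_neq0 //; split=> //.
  apply: (same_scheme_scale (c := ((g 0 0 * g 1 1 - g 0 1 * g 1 0) * (h 0 0 * h 1 1 - h 0 1 * h 1 0)))).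
    by rewrite mulf_neq0.
  by expand_minors; ring.
by move=> f /max_minorsP [k [l [_ ->]]]; expand_minors; ring.
Qed.

Lemma in_case_tensor4a1 (g : 'M_(1, 2)) (m : 'M_(2, 3)) : row_free g -> row_free m ->
  in_case (mulT g h m (tensor4a1 F)) Case4a.
Proof.
move=> fg fm; split; first by expand_minors; ring.
left; exists (linform (g 0)); rewrite linform_homog row_free_linform_neq0 //; split=> //.
have [k [l mkl]] := row_free2_minor fm.
apply: (same_scheme_minors (c := fun k l => (h 0 0 * h 1 1 - h 0 1 * h 1 0) * (m 0 k * m 1 l - m 0 l * m 1 k))).
  by move=> k' l'; expand_minors; ring.
by exists k, l; rewrite mulf_neq0.
Qed.

Lemma in_case_tensor4a2 (g : 'M_(1, 2)) (m : 'M_(2, 3)) : row_free g -> row_free m ->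
  in_case (mulT h g m (tensor4a2 F)) Case4a.
Proof.
move=> fg fm; split; first by expand_minors; ring.
right; exists (linform (g 0)); rewrite linform_homog row_free_linform_neq0 //; split=> //.
have [k [l mkl]] := row_free2_minor fm.
apply: (same_scheme_minors (c := fun k l => (h 0 0 * h 1 1 - h 0 1 * h 1 0) * (m 0 k * m 1 l - m 0 l * m 1 k))).
  by move=> k' l'; expand_minors; ring.
by exists k, l; rewrite mulf_neq0.
Qed.

End InCase.

Lemma in_case_tensor4b (g : 'M_(1, 2)) (h : 'M_(1, 2)) (m : 'M_(1, 3)) :
  in_case (mulT g h m (tensor4b F)) Case4b.
Proof.
split; first by expand_minors; ring.
by split; apply: zero_gens_whole => f /max_minorsP [k [l [_ ->]]]; expand_minors; ring.
Qed.

End Consequences.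

(** * Tensor ranks of the normal forms *)

Section Ranks.
Variable F : fieldType.
Implicit Types (A : hypermatrix F).

Definition equivalent_to p q r (T : tensor F p q r) A : Prop :=
  exists g h m, [/\ row_free g, row_free h, row_free m & A = mulT g h m T].

Lemma equivalent_Fess p q r (T : tensor F p q r) A :
  concise_tensor T -> equivalent_to T A -> Fess A p q r.
Proof. by move=> cT [g [h [m [fg fh fm AE]]]]; apply: Fess_mulT AE. Qed.

(** A decomposition with no more terms than the largest entry of the essential format is
    automatically minimal. *)
Lemma equivalent_tensor_rank p q r (T : tensor F p q r) A s :
  concise_tensor T -> equivalent_to T A -> decomposes T s ->
  (s <= maxn p (maxn q r))%N -> has_tensor_rank A s.
Proof.
move=> cT AT Ts s_le; have FA := equivalent_Fess cT AT; split.
  apply/sum_of_decomposablesE; have [g [h [m [_ _ _ ->]]]] := AT.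
  exact: decomposes_mulT.
move=> s' /(Fess_tensor_rank FA) [ps qs rs]; apply: leq_trans s_le _.
by rewrite !geq_max ps qs rs.
Qed.

Lemma decomposes_crit p q r (T : tensor F p q r) s
    (a : 'I_s -> 'I_p -> F) (b : 'I_s -> 'I_q -> F) (c : 'I_s -> 'I_r -> F) :
  (forall i j k, T i j k = \sum_l a l i * b l j * c l k) -> decomposes T s.
Proof.
move=> TE; exists (\matrix_(l, i) a l i), (\matrix_(l, i) b l i), (\matrix_(l, i) c l i).
by apply: tensorP => i j k; rewrite mulT_unit TE; apply: eq_bigr => l _; rewrite !mxE.
Qed.

(** In the decompositions below, lists of indices record the positions of the nonzero entries of a
    normal form. *)
Definition basis_vector n (a : nat) (i : 'I_n) : F := if a == i then 1 else 0.

Lemma decomposes_tensor2a : decomposes (tensor2a F) 3.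
Proof.
apply: (decomposes_crit (a := fun l => basis_vector (nth 0 [:: 0; 0; 1] l)%N)
  (b := fun l => basis_vector (nth 0 [:: 0; 1; 0] l)%N) (c := fun l => basis_vector l)).
elim/ord2P; elim/ord2P; elim/ord3P; rewrite sum3 /tensor2a /basis_vector /=; ring.
Qed.

Lemma decomposes_tensor2b : decomposes (tensor2b F) 2.
Proof.
apply: (decomposes_crit (a := fun l => basis_vector l) (b := fun l => basis_vector l) (c := fun l => basis_vector l)).
elim/ord2P; elim/ord2P; elim/ord2P; rewrite sum2 /tensor2b /basis_vector /=; ring.
Qed.

Lemma decomposes_tensor3a : decomposes (tensor3a F) 3.
Proof.
apply: (decomposes_crit (a := fun l => basis_vector (nth 0 [:: 0; 0; 1] l)%N)
  (b := fun l => basis_vector (nth 0 [:: 0; 1; 0] l)%N)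
  (c := fun l => basis_vector (nth 0 [:: 0; 1; 1] l)%N)).
elim/ord2P; elim/ord2P; elim/ord2P; rewrite sum3 /tensor3a /basis_vector /=; ring.
Qed.

Lemma decomposes_tensor3b : decomposes (tensor3b F) 2.
Proof.
apply: (decomposes_crit (a := fun l => basis_vector l) (b := fun l => basis_vector l) (c := fun _ _ => 1)).
elim/ord2P; elim/ord2P => k; rewrite sum2 /tensor3b /basis_vector /=; ring.
Qed.

Lemma decomposes_tensor4a1 : decomposes (tensor4a1 F) 2.
Proof.
apply: (decomposes_crit (a := fun _ _ => 1) (b := fun l => basis_vector l) (c := fun l => basis_vector l)).
move=> i; elim/ord2P; elim/ord2P; rewrite sum2 /tensor4a1 /basis_vector /=; ring.
Qed.

Lemma decomposes_tensor4a2 : decomposes (tensor4a2 F) 2.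
Proof.
apply: (decomposes_crit (a := fun l => basis_vector l) (b := fun _ _ => 1) (c := fun l => basis_vector l)).
elim/ord2P => j; elim/ord2P; rewrite sum2 /tensor4a2 /basis_vector /=; ring.
Qed.

Lemma decomposes_tensor4b : decomposes (tensor4b F) 1.
Proof.
apply: (decomposes_crit (a := fun _ _ => 1) (b := fun _ _ => 1) (c := fun _ _ => 1)).
move=> i j k; rewrite big_ord1 /tensor4b; ring.
Qed.

(* The slices satisfy [det (s * T_0 + t * T_1) = - t ^+ 2], whereas two
   decomposable summands would give [D * w_0(s, t) * w_1(s, t)] with [w_0] and
   [w_1] linear: both would be multiples of [t], and [T_0] would vanish. *)
Lemma tensor3a_not_rank2 : ~ decomposes (tensor3a F) 2.
Proof.
case=> a [b [c Tabc]].
have E i j k : tensor3a F i j k = a 0 i * b 0 j * c 0 k + a 1 i * b 1 j * c 1 k.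
  by rewrite Tabc mulT_unit sum2.
pose D := (a 0 0 * a 1 1 - a 0 1 * a 1 0) * (b 0 0 * b 1 1 - b 0 1 * b 1 0).
pose T i j k := tensor3a F i j k.
have dss : D * (c 0 0 * c 1 0) = 0.
  transitivity (T 0 0 0 * T 1 1 0 - T 0 1 0 * T 1 0 0).
    by rewrite /T !E /D; ring.
  by rewrite /T /tensor3a /=; ring.
have dst : D * (c 0 0 * c 1 1 + c 0 1 * c 1 0) = 0.
  transitivity (T 0 0 0 * T 1 1 1 + T 0 0 1 * T 1 1 0 - T 0 1 0 * T 1 0 1 - T 0 1 1 * T 1 0 0).
    by rewrite /T !E /D; ring.
  by rewrite /T /tensor3a /=; ring.
have dtt : D * (c 0 1 * c 1 1) != 0.
  have -> : D * (c 0 1 * c 1 1) = T 0 0 1 * T 1 1 1 - T 0 1 1 * T 1 0 1.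
    by rewrite /T !E /D; ring.
  by rewrite /T /tensor3a /= !mul0r mul1r sub0r oppr_eq0 oner_neq0.
move: dtt; rewrite mulf_eq0 => /norP [D0]; rewrite mulf_eq0 => /norP [c01 c11].
move/eqP: dst; rewrite mulf_eq0 (negPf D0) /= => /eqP dst.
have c00 : c 0 0 = 0 /\ c 1 0 = 0.
  move/eqP: dss; rewrite mulf_eq0 (negPf D0) mulf_eq0 /= => /orP [] /eqP z; split=> //; move: dst; rewrite z.
  - by rewrite mul0r add0r => /eqP; rewrite mulf_eq0 (negPf c01) => /eqP.
  - by rewrite mulr0 addr0 => /eqP; rewrite mulf_eq0 (negPf c11) orbF => /eqP.
have /eqP := oner_neq0 F; apply; have := E 0 0 0.
by rewrite c00.1 c00.2 /tensor3a /= => ->; ring.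
Qed.

(** The format gives rank at least 2; a decomposition into two terms is pulled back to [tensor3a],
    which has none. *)
Lemma equivalent_3a_rank A : equivalent_to (tensor3a F) A -> has_tensor_rank A 3.
Proof.
move=> AT; have FA := equivalent_Fess (@concise_tensor3a F) AT.
have [g [h [m [fg fh fm AE]]]] := AT; split.
  by apply/sum_of_decomposablesE; rewrite AE; apply/decomposes_mulT/decomposes_tensor3a.
move=> s As; have [s2 _ _] := Fess_tensor_rank FA As.
rewrite ltn_neqAle s2 andbT; apply/eqP => s2'; apply: tensor3a_not_rank2.
have [g' [h' [m' inv]]] := mulT_inverse fg fh fm.
by rewrite [tensor3a F]inv -AE; apply/decomposes_mulT/sum_of_decomposablesE; rewrite s2'.
Qed.

End Ranks.

(** * Reduction of hypermatrices with an isotropic pair to normal forms *)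

Section Classification.
Variable F : fieldType.
Implicit Types (A : hypermatrix F).

Definition rows1 n (v : 'I_n -> F) : 'M_(1, n) := \matrix_(a, k) v k.
Definition rows2 n (v w : 'I_n -> F) : 'M_(2, n) := \matrix_(a, k) pair_of v w a k.
Definition rows3 n (u v w : 'I_n -> F) : 'M_(3, n) := \matrix_(a, k) nth u [:: u; v; w] a k.

Lemma row_free_rows1 n (v : 'I_n -> F) k : v k != 0 -> row_free (rows1 v).
Proof.
move=> vk; apply: row_free_crit => u /(_ k); rewrite big_ord1 mxE => /eqP.
by rewrite mulf_eq0 (negPf vk) orbF => /eqP u0 a; rewrite ord1.
Qed.

Lemma row_free_rows2_comb (g : 'M[F]_2) (a b c d : F) : row_free g -> a * d - b * c != 0 ->
  row_free (rows2 (fun i => a * g 0 i + b * g 1 i) (fun i => c * g 0 i + d * g 1 i)).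
Proof.
move=> /row_free_det2 dg d0; rewrite row_free_unit unitmxE unitfE det2E !mxE /pair_of /=.
apply/negP => /eqP E; have /negP := mulf_neq0 d0 dg; apply; apply/eqP.
by rewrite -[RHS]E; ring.
Qed.

Lemma not_row_free_rows2 n (v w : 'I_n -> F) : ~~ row_free (rows2 v w) ->
  exists u s t, (forall k, v k = s * u k) /\ (forall k, w k = t * u k).
Proof.
move=> /not_row_free [c [[a ca] vw]].
have E k : c 0 * v k + c 1 * w k = 0 by rewrite -[RHS](vw k) sum2 !mxE.
move: a ca; elim/ord2P => c0.
- exists w, (- (c 1 / c 0)), 1; split=> k; last by rewrite mul1r.
  by apply: (mulfI c0); rewrite -[LHS](addrK (c 1 * w k)) E; field.
- exists v, 1, (- (c 0 / c 1)); split=> k; first by rewrite mul1r.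
  by apply: (mulfI c0); rewrite -[LHS](addKr (c 0 * v k)) E; field.
Qed.

(** The vector is placed in row 1 so that, for an isotropic pair, the vanishing entry lands in
    position (1, 1). *)
Lemma complete_basis2 (x : 'I_2 -> F) : proj_point x ->
  exists X : 'M_2, X \in unitmx /\ forall i, X 1 i = x i.
Proof.
case; elim/ord2P => xi.
- exists (rows2 (pair_of 0 1) x); split=> [|i]; last by rewrite mxE.
  by rewrite unitmxE unitfE det2E !mxE /pair_of /= mul0r mul1r sub0r oppr_eq0.
- exists (rows2 (pair_of 1 0) x); split=> [|i]; last by rewrite mxE.
  by rewrite unitmxE unitfE det2E !mxE /pair_of /= mul0r mul1r subr0.
Qed.

Lemma isotropic_shape A x y : isotropic A x y ->
  exists g h : 'M[F]_2, [/\ row_free g, row_free h &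
    exists p q r, forall i j k, A i j k =
      g 0 i * h 0 j * p k + g 0 i * h 1 j * q k + g 1 i * h 0 j * r k].
Proof.
case=> /complete_basis2 [X [Xu X1]] /complete_basis2 [Y [Yu Y1]] xy.
pose n := mulT X^T Y^T 1%:M A.
have AE : A = mulT (invmx X^T) (invmx Y^T) 1%:M n.
  by rewrite /n mulTA !mulmxV ?unitmx_tr // mulmx1 mulT1.
have mul3_1 p q r (T : tensor F p q r) : mul3 1%:M T = T.
  apply: tensorP => i j k; rewrite /mul3 (bigD1 k) //= mxE eqxx mul1r big1 ?addr0 // => a ak.
  by rewrite mxE (negPf ak) mul0r.
have n11 k : n 1 1 k = 0.
  rewrite -[RHS](xy k) /n /mulT mul3_1; apply: eq_bigr => i _; rewrite mulr_sumr.
  by apply: eq_bigr => j _; rewrite !mxE X1 Y1; ring.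
exists (invmx X^T), (invmx Y^T); rewrite !row_free_unit !unitmx_inv !unitmx_tr; split=> //.
exists (n 0 0), (n 0 1), (n 1 0) => i j k.
rewrite {1}AE /mulT mul3_1 /mul1 /mul2 !sum2 n11; ring.
Qed.

Ltac expand_mulT := rewrite /mulT /mul1 /mul2 /mul3 ?(sum2, sum3, big_ord1)
  /tensor2a /tensor2b /tensor3a /tensor3b /tensor4a1 /tensor4a2 /tensor4b
  ?mxE /pair_of /=.

Section Shapes.
Variable A : hypermatrix F.
Hypothesis hA : hnonzero A.
Implicit Types (g h : 'M[F]_2) (v w : 'I_3 -> F).

Lemma equivalent_4b a b v :
  (forall i j k, A i j k = a i * b j * v k) -> equivalent_to (tensor4b F) A.
Proof.
move=> AE; case: hA => i [j [k]]; rewrite AE !mulf_eq0 !negb_or -andbA => /and3P [ai bj vk].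
exists (rows1 a), (rows1 b), (rows1 v); split; try exact: row_free_rows1.
- exact: row_free_rows1 ai.
- exact: row_free_rows1 bj.
- exact: row_free_rows1 vk.
by apply: tensorP => *; rewrite AE; expand_mulT; ring.
Qed.

Lemma equivalent_4a1 a h v w : row_free h -> row_free (rows2 v w) ->
  (forall i j k, A i j k = a i * (h 0 j * v k + h 1 j * w k)) -> equivalent_to (tensor4a1 F) A.
Proof.
move=> fh fvw AE; case: hA => i [j [k]]; rewrite AE mulf_eq0 negb_or => /andP [ai _].
exists (rows1 a), h, (rows2 v w); split=> //; first exact: row_free_rows1 ai.
by apply: tensorP => *; rewrite AE; expand_mulT; ring.
Qed.

Lemma equivalent_4a2 b g v w : row_free g -> row_free (rows2 v w) ->
  (forall i j k, A i j k = b j * (g 0 i * v k + g 1 i * w k)) -> equivalent_to (tensor4a2 F) A.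
Proof.
move=> fg fvw AE; case: hA => i [j [k]]; rewrite AE mulf_eq0 negb_or => /andP [bj _].
exists g, (rows1 b), (rows2 v w); split=> //; first exact: row_free_rows1 bj.
by apply: tensorP => *; rewrite AE; expand_mulT; ring.
Qed.

Lemma equivalent_3b g h v : row_free g -> row_free h ->
  (forall i j k, A i j k = (g 0 i * h 0 j + g 1 i * h 1 j) * v k) -> equivalent_to (tensor3b F) A.
Proof.
move=> fg fh AE; case: hA => i [j [k]]; rewrite AE mulf_eq0 negb_or => /andP [_ vk].
exists g, h, (rows1 v); split=> //; first exact: row_free_rows1 vk.
by apply: tensorP => *; rewrite AE; expand_mulT; ring.
Qed.

Lemma equivalent_3a g h v w : row_free g -> row_free h -> row_free (rows2 v w) ->
  (forall i j k, A i j k = g 0 i * h 0 j * v k + (g 0 i * h 1 j + g 1 i * h 0 j) * w k) ->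
  equivalent_to (tensor3a F) A.
Proof.
move=> fg fh fvw AE; exists g, h, (rows2 v w); split=> //.
by apply: tensorP => *; rewrite AE; expand_mulT; ring.
Qed.

Lemma equivalent_2b g h v w : row_free g -> row_free h -> row_free (rows2 v w) ->
  (forall i j k, A i j k = g 0 i * h 0 j * v k + g 1 i * h 1 j * w k) ->
  equivalent_to (tensor2b F) A.
Proof.
move=> fg fh fvw AE; exists g, h, (rows2 v w); split=> //.
by apply: tensorP => *; rewrite AE; expand_mulT; ring.
Qed.

Lemma equivalent_2a g h u v w : row_free g -> row_free h -> row_free (rows3 u v w) ->
  (forall i j k, A i j k = g 0 i * h 0 j * u k + g 0 i * h 1 j * v k + g 1 i * h 0 j * w k) ->
  equivalent_to (tensor2a F) A.
Proof.
move=> fg fh fvw AE; exists g, h, (rows3 u v w); split=> //.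
by apply: tensorP => *; rewrite AE; expand_mulT; ring.
Qed.

(** Up to a nonzero scalar det N is the product of [q] and [r], so their independence detects a
    conic of two distinct lines. The position of [p] relative to their span then separates the
    subcases. *)
Lemma isotropic_normal_form x y : isotropic A x y ->
  (equivalent_to (tensor2a F) A \/ equivalent_to (tensor2b F) A) \/
  (equivalent_to (tensor3a F) A \/ equivalent_to (tensor3b F) A) \/
  (equivalent_to (tensor4a1 F) A \/ equivalent_to (tensor4a2 F) A) \/
  equivalent_to (tensor4b F) A.
Proof.
move=> /isotropic_shape [g [h [fg fh [p [q [r AE]]]]]].
have [fqr|] := boolP (row_free (rows2 q r)).
  left; have [fpqr|] := boolP (row_free (rows3 p q r)).
    by left; apply: equivalent_2a AE.
  move=> /not_row_free [u [u0 uE]]; right.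
  have E k : u 0 * p k + u 1 * q k + u ord_max * r k = 0.
    by rewrite -[RHS](uE k) sum3 !mxE.
  have u00 : u 0 != 0.
    apply/eqP => z; have z' := row_free_kill (u := pair_of (u 1) (u ord_max)) fqr.
    have uz : forall a, pair_of (u 1) (u ord_max) a = 0.
      by apply: z' => k; rewrite sum2 !mxE /pair_of /= -[RHS](E k) z mul0r add0r.
    case: u0 => a /eqP; apply; move: a; elim/ord3P => //; [exact: (uz 0) | exact: (uz 1)].
  (* Since p = s q + t r, the tensor regroups as g0 (s h0 + h1) q + (t g0 + g1) h0 r, which is
     diagonal in new bases. *)
  pose s := - (u 1 / u 0); pose t := - (u ord_max / u 0).
  have pE k : p k = s * q k + t * r k.
    apply: (mulfI u00); apply/eqP; rewrite -subr_eq0; apply/eqP.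
    by rewrite -[RHS](E k) /s /t; field.
  apply: (equivalent_2b (row_free_rows2_comb (a := 1) (b := 0) (c := t) (d := 1) fg _)
    (row_free_rows2_comb (a := s) (b := 1) (c := 1) (d := 0) fh _) fqr).
  - by rewrite mulr1 mul0r subr0 oner_neq0.
  - by rewrite mulr0 mulr1 sub0r oppr_eq0 oner_neq0.
  by move=> i j k; rewrite AE pE !mxE /pair_of /=; ring.
move=> /not_row_free_rows2 [v [s [t [qE rE]]]]; right.
have [fpv|] := boolP (row_free (rows2 p v)).
  (* N is now [[p, s v], [t v, 0]] with [p] and [v] independent. If [s] and [t] are both nonzero,
     rescaling the bases makes it symmetric; otherwise it is a row, a column or a single entry. *)
  have [s0|s0] := eqVneq s 0; have [t0|t0] := eqVneq t 0.
  - right; right; apply: (equivalent_4b (a := g 0) (b := h 0) (v := p)) => i j k.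
    by rewrite AE qE rE s0 t0; ring.
  - right; left; right.
    apply: (equivalent_4a2 (b := h 0) (row_free_rows2_comb (a := 1) (b := 0) (c := 0) (d := t) fg _) fpv).
      by rewrite mul1r mul0r subr0.
    by move=> i j k; rewrite AE qE rE s0 !mxE /pair_of /=; ring.
  - right; left; left.
    apply: (equivalent_4a1 (a := g 0) (row_free_rows2_comb (a := 1) (b := 0) (c := 0) (d := s) fh _) fpv).
      by rewrite mul1r mul0r subr0.
    by move=> i j k; rewrite AE qE rE t0 !mxE /pair_of /=; ring.
  - left; left.
    apply: (equivalent_3a (row_free_rows2_comb (a := 1) (b := 0) (c := 0) (d := t) fg _)
      (row_free_rows2_comb (a := 1) (b := 0) (c := 0) (d := s) fh _) fpv).
    + by rewrite mul1r mul0r subr0.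
    + by rewrite mul1r mul0r subr0.
    by move=> i j k; rewrite AE qE rE !mxE /pair_of /=; ring.
(* All slices are now multiples of the single matrix [[a, b s], [b t, 0]], of rank 2 exactly when
   [b * s] and [b * t] are both nonzero. *)
move=> /not_row_free_rows2 [w [a [b [pE vE]]]].
have [s0|s0] := eqVneq (b * s) 0.
  right; right; apply: (equivalent_4b (a := fun i => a * g 0 i + b * t * g 1 i) (b := h 0) (v := w)) => i j k.
  by rewrite AE qE rE pE vE [s * _]mulrA [s * b]mulrC s0; ring.
have [t0|t0] := eqVneq (b * t) 0.
  right; right; apply: (equivalent_4b (a := g 0) (b := fun j => a * h 0 j + b * s * h 1 j) (v := w)) => i j k.
  by rewrite AE qE rE pE vE [t * _]mulrA [t * b]mulrC t0; ring.
left; right.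
apply: (equivalent_3b (v := w) (row_free_rows2_comb (a := 1) (b := 0) (c := 0) (d := b * t) fg _)
      (row_free_rows2_comb (a := a) (b := b * s) (c := 1) (d := 0) fh _)).
- by rewrite mul1r mul0r subr0.
- by rewrite mulr0 mulr1 sub0r oppr_eq0.
by move=> i j k; rewrite AE qE rE pE vE !mxE /pair_of /=; ring.
Qed.

End Shapes.
End Classification.

(** * Exclusiveness of the cases and transfer of the conclusions *)

Section Cases.
Variable F : closedFieldType.
Implicit Types (A : hypermatrix F).

Lemma double_not_two n (gs : seq {mpoly F[n]}) : is_double_hyperplane gs -> ~ is_two_hyperplanes gs.
Proof.
move=> [l [lh l0 s]] [l1 [l2 [h1 h2 l20 l12 s12]]].
exact: (not_linform_and_product lh l0 h1 h2 l20 l12 s s12).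
Qed.

Lemma hyperplane_not_two n (gs : seq {mpoly F[n]}) : is_hyperplane gs -> ~ is_two_hyperplanes gs.
Proof.
move=> [l [lh l0 s]] [l1 [l2 [h1 h2 l20 l12 s12]]].
by apply: (@not_linform_and_product _ _ gs l l1 l2 0).
Qed.

Lemma double_not_whole n (gs : seq {mpoly F[n.+1]}) : is_double_hyperplane gs -> ~ is_whole_space gs.
Proof.
by move=> [l [lh l0 s]]; apply: (not_whole_and_nonzero ord0 s); rewrite expf_neq0.
Qed.

Lemma two_not_whole n (gs : seq {mpoly F[n.+1]}) : is_two_hyperplanes gs -> ~ is_whole_space gs.
Proof.
move=> [l1 [l2 [h1 h2 l20 l12 s]]]; apply: (not_whole_and_nonzero ord0 s).
by rewrite mulf_neq0 //; have := l12 0; rewrite scale0r.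
Qed.

Lemma smooth_not_two (f : {mpoly F[3]}) : is_smooth_hypersurface f -> ~ is_two_hyperplanes [:: f].
Proof. by move=> fs [l1 [l2 [h1 h2 _ _]]]; apply: smooth_not_product. Qed.

Lemma smooth_not_double (f : {mpoly F[3]}) : is_smooth_hypersurface f -> ~ is_double_hyperplane [:: f].
Proof. by move=> fs [l [lh _]]; rewrite expr2; apply: smooth_not_product. Qed.

Lemma in_case_unique A c c' : in_case A c -> in_case A c' -> c = c'.
Proof.
rewrite /in_case; set f := \det (Nmx A); set l := max_minors (Lmx A); set m := max_minors (Mmx A).
have s0 : is_smooth_hypersurface f -> f <> 0 by case=> /eqP.
have s2 := @smooth_not_two f; have sd := @smooth_not_double f.
have f0w : f = 0 -> is_whole_space [:: f].
  by move=> f0; apply: zero_gens_whole => g; rewrite inE => /eqP ->.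
have fw2 := @two_not_whole _ [:: f]; have fwd := @double_not_whole _ [:: f].
have f2d := @double_not_two _ [:: f].
have l12 := @hyperplane_not_two _ l; have lw := @zero_gens_whole _ _ l.
have ldw := @double_not_whole _ l; have mdw := @double_not_whole _ m.
(* Once the predicates are generalized to propositional variables, the 49 pairs of cases are settled
   by propositional logic. *)
move: s0 s2 sd f0w fw2 fwd f2d l12 lw ldw mdw; rewrite /=.
move: (is_smooth_hypersurface f) (is_two_hyperplanes [:: f]) (is_double_hyperplane [:: f])
  (is_whole_space [:: f]) (f = 0) (is_hyperplane l) (is_two_hyperplanes l)
  (is_double_hyperplane l) (is_whole_space l) (forall g, g \in l -> g = 0)
  (is_double_hyperplane m) (is_whole_space m).
by case: c; case: c' => //=; tauto.
Qed.

Definition case_conclusion A c : Prop :=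
  match c with
  | Case1 => [/\ forall D : dual_poly F, is_hyperdeterminant D -> heval D A <> 0,
                 concise A & has_tensor_rank A 3]
  | Case2a => concise A /\ has_tensor_rank A 3
  | Case2b => [/\ ~ concise A, Fess A 2 2 2 & has_tensor_rank A 2]
  | Case3a => [/\ ~ concise A, Fess A 2 2 2 & has_tensor_rank A 3]
  | Case3b => [/\ ~ concise A, Fess A 2 2 1 & has_tensor_rank A 2]
  | Case4a => [/\ ~ concise A, Fess A 1 2 2 \/ Fess A 2 1 2 & has_tensor_rank A 2]
  | Case4b => [/\ ~ concise A, has_tensor_rank A 1 & Fess A 1 1 1]
  end.

Lemma Fess_not_concise A p q r : Fess A p q r -> (p, q, r) <> (2, 2, 3)%N -> ~ concise A.
Proof. by move=> FA pqr /(Fess_unique FA) [p2 q2 r3]; apply: pqr; rewrite p2 q2 r3. Qed.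

Lemma anisotropic_conclusion A : 2%:R != 0 :> F -> ~ (exists x y, isotropic A x y) ->
  in_case A Case1 /\ case_conclusion A Case1.
Proof.
move=> F2 noA; have sA := anisotropic_smooth noA; split=> //.
have cA := anisotropic_concise noA; split=> //.
  by move=> D; apply: smooth_hyperdeterminant.
split; first exact: anisotropic_decomposables.
by move=> s /(Fess_tensor_rank cA) [].
Qed.

Lemma isotropic_conclusion A x y : hnonzero A -> isotropic A x y ->
  exists c, in_case A c /\ case_conclusion A c.
Proof.
move=> hA /(isotropic_normal_form hA).
move=> [[E|E]|[[E|E]|[[E|E]|E]]]; have [g [h [m [fg fh fm AE]]]] := E.
- exists Case2a; split; first by rewrite AE; apply: in_case_tensor2a.
  split; first exact: equivalent_Fess (@concise_tensor2a F) E.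
  exact: equivalent_tensor_rank (@concise_tensor2a F) E (@decomposes_tensor2a F) _.
- have FA := equivalent_Fess (@concise_tensor2b F) E.
  exists Case2b; split; first by rewrite AE; apply: in_case_tensor2b.
  split=> //; first exact: Fess_not_concise FA _.
  exact: equivalent_tensor_rank (@concise_tensor2b F) E (@decomposes_tensor2b F) _.
- have FA := equivalent_Fess (@concise_tensor3a F) E.
  exists Case3a; split; first by rewrite AE; apply: in_case_tensor3a.
  split=> //; first exact: Fess_not_concise FA _.
  exact: equivalent_3a_rank.
- have FA := equivalent_Fess (@concise_tensor3b F) E.
  exists Case3b; split; first by rewrite AE; apply: in_case_tensor3b.
  split=> //; first exact: Fess_not_concise FA _.
  exact: equivalent_tensor_rank (@concise_tensor3b F) E (@decomposes_tensor3b F) _.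
- have FA := equivalent_Fess (@concise_tensor4a1 F) E.
  exists Case4a; split; first by rewrite AE; apply: in_case_tensor4a1.
  split; [exact: Fess_not_concise FA _ | by left |].
  exact: equivalent_tensor_rank (@concise_tensor4a1 F) E (@decomposes_tensor4a1 F) _.
- have FA := equivalent_Fess (@concise_tensor4a2 F) E.
  exists Case4a; split; first by rewrite AE; apply: in_case_tensor4a2.
  split; [exact: Fess_not_concise FA _ | by right |].
  exact: equivalent_tensor_rank (@concise_tensor4a2 F) E (@decomposes_tensor4a2 F) _.
- have FA := equivalent_Fess (@concise_tensor4b F) E.
  exists Case4b; split; first by rewrite AE; apply: in_case_tensor4b.
  split=> //; first exact: Fess_not_concise FA _.
  exact: equivalent_tensor_rank (@concise_tensor4b F) E (@decomposes_tensor4b F) _.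
Qed.

Lemma isotropic_degenerate A x y : hnonzero A -> isotropic A x y ->
  [/\ forall D : dual_poly F, is_hyperdeterminant D -> heval D A = 0,
      degenerate_scheme (Lmx A), degenerate_scheme (Mmx A) & degenerate_scheme (Nmx A)].
Proof.
move=> hA iA; have [x0 y0 _] := iA; have [z [z0 sA]] := isotropic_singular iA; split.
- by move=> D; apply: hyperdeterminant_singular sA.
- exact: singular_triple_degenerate_Lmx sA.
- exact: singular_triple_degenerate_Mmx sA.
- exact: singular_triple_degenerate_Nmx sA.
Qed.

Lemma classification A : 2%:R != 0 :> F -> hnonzero A ->
  exists c, in_case A c /\ case_conclusion A c.
Proof.
move=> F2 hA; have [[x [y iA]]|noA] := pselect (exists x y, isotropic A x y).
  exact: isotropic_conclusion iA.
by exists Case1; apply: anisotropic_conclusion.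
Qed.

(** The conclusions are not deduced from the hypotheses of case [c]: the classification provides
    some case along with its conclusions, and uniqueness identifies it with [c]. *)
Lemma in_case_conclusion A c : 2%:R != 0 :> F -> hnonzero A ->
  in_case A c -> case_conclusion A c.
Proof.
move=> F2 hA Ac; have [c' [Ac' conc]] := classification F2 hA.
by rewrite (in_case_unique Ac Ac').
Qed.

Lemma in_case_degenerate A c : 2%:R != 0 :> F -> hnonzero A -> c <> Case1 -> in_case A c ->
  [/\ forall D : dual_poly F, is_hyperdeterminant D -> heval D A = 0,
      degenerate_scheme (Lmx A), degenerate_scheme (Mmx A) & degenerate_scheme (Nmx A)].
Proof.
move=> F2 hA c1 Ac; have [[x [y iA]]|noA] := pselect (exists x y, isotropic A x y).
  exact: isotropic_degenerate iA.
(* Without isotropic pair [A] would also lie in [Case1], so [c] would be [Case1]. *)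
by case: c1; apply: in_case_unique Ac _; case: (anisotropic_conclusion F2 noA).
Qed.

End Cases.

Local Open Scope complex_scope.

Theorem mainTheorem4 (R : realType) (A : hypermatrix R[i]) (hA : hnonzero A) :
  [/\ exists! c : hcase, in_case A c,
      [/\ in_case A Case1 ->
            [/\ forall D : dual_poly R[i], is_hyperdeterminant D -> heval D A <> 0,
                concise A & has_tensor_rank A 3],
          in_case A Case2a -> concise A /\ has_tensor_rank A 3,
          in_case A Case2b ->
            [/\ ~ concise A, Fess A 2 2 2 & has_tensor_rank A 2]
        & in_case A Case3a ->
            [/\ ~ concise A, Fess A 2 2 2 & has_tensor_rank A 3]],
      [/\ in_case A Case3b ->
            [/\ ~ concise A, Fess A 2 2 1 & has_tensor_rank A 2],
          in_case A Case4a ->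
            [/\ ~ concise A, Fess A 1 2 2 \/ Fess A 2 1 2 & has_tensor_rank A 2]
        & in_case A Case4b ->
            [/\ ~ concise A, has_tensor_rank A 1 & Fess A 1 1 1]]
    & forall c : hcase, c <> Case1 -> in_case A c ->
        [/\ forall D : dual_poly R[i], is_hyperdeterminant D -> heval D A = 0,
            degenerate_scheme (Lmx A), degenerate_scheme (Mmx A)
          & degenerate_scheme (Nmx A)]].
Proof.
have F2 : 2%:R != 0 :> R[i] by rewrite Num.Theory.pnatr_eq0.
have conc c := @in_case_conclusion R[i] A c F2 hA.
split; last by move=> c; apply: (@in_case_degenerate R[i]).
- have [c [Ac _]] := @classification R[i] A F2 hA.
  by exists c; split=> // c'; apply: (@in_case_unique R[i]).
- by split; apply: (conc _).
- by split; apply: (conc _).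
Qed.
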